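(* Fix a natural number $n$, and consider the model structure on the category $\mathrm{RelPsh}(\square)$ of relational precubical sets whose cofibrations are $\mathrm{LLP}(\mathrm{RLP}(I))$, whose weak equivalences are $\mathrm{RLP}(I)$ and in which every morphism is a fibration, where $I=I_+\cup\{\nabla_i\mid i\in I_+\}$ is defined in the context. Then: (1) a relational precubical set is cofibrant if and only if it is $n$-euclidean; (2) the cofibrant replacement is the $n$-blowup: for every relational precubical set $P$, the blowup map $\beta_P:\tilde P\to P$ is a cofibrant replacement of $P$, i.e. $\tilde P$ is cofibrant and $\beta_P$ is a trivial fibration.
   Context: Relational presheaves. A relational presheaf $P$ over a category $\mathcal{C}$ is a lax functor $\mathcal{C}^{op}\to\mathrm{Rel}$: sets $P(c)$ for $c\in\mathcal{C}$ and relations $P(f)\subseteq P(c)\times P(d)$ for $f:d\to c$ (write $a\to_f b$ for $(a,b)\in P(f)$), such that $x\to_{\mathrm{id}_c}x$ for all $x\in P(c)$, and $a\to_f b$, $b\to_g e$ imply $a\to_{f\circ g}e$ for composable $f,g$. A morphism $\alpha:P\to Q$ is a family of functions $\alpha_c:P(c)\to Q(c)$ such that $a\to_f b$ implies $\alpha_c(a)\to_f\alpha_d(b)$. These form the category $\mathrm{RelPsh}(\mathcal{C})$; presheaves are the special case of functional relations. Precubical sets. The cube category $\square$ has objects the natural numbers and morphisms generated by $d^{\eta}_{n,i}:n\to n+1$ ($\eta\in\{-,+\}$, $0\le i\le n$), subject to $d^{\eta'}_{n+1,j}\circ d^{\eta}_{n,i}=d^{\eta}_{n+1,i}\circ d^{\eta'}_{n,j-1}$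 for $0\le i<j\le n+1$. A (relational) precubical set is a (relational) presheaf over $\square$; elements of $P(k)$ are the $k$-cubes of $P$; $P(d^-_{k,i})$ and $P(d^+_{k,i})$ give back and front faces in direction $i$. Tensor product of precubical sets: $(P\otimes Q)(k)=\bigsqcup_{i+j=k}P(i)\times Q(j)$ with the obvious face maps. Graphs are viewed as precubical sets of dimension $\le 1$ (back face of an edge = source, front face = target). Upward neighborhood. For a cube $c$ of $P$, $\uparrow c$ is the relational precubical set whose cubes are pairs $(d,f)$ with $d\to_f c$ in $P$ (with the dimension of $d$), and whose relations are $(d',g\circ f)\to_g(d,f)$ whenever $d'\to_g d$ in $P$. Euclidean bricks ($n$ fixed). Let $V_0=\cdot\to\cdot$ be the graph with one edge $p_0$ and $V_1=\cdot\to\cdot\to\cdot$ the graph with two consecutive edges, with central vertex $p_1$. For $\epsilon\in\{0,1\}^n$ let $c(\epsilon)=(p_{\epsilon_1},\dots,p_{\epsilon_n})$, a cube of the precubical set $\bigotimes_{1\le i\le n}V_{\epsilon_i}$. The euclidean brick is $B_\epsilon:=\uparrow c(\epsilon)$ (so, explicitly, its cubes are the tuples $(x_1,\dots,x_n)$ with $x_i=p_0$ if $\epsilon_i=0$ and $x_i\in\{p_1,\text{first edge},\text{second edge}\}$ if $\epsilon_i=1$). Its codimension is $\epsilon_1+\dots+\epsilon_n$. If this is $k$, $B_\epsilon$ has a unique $(n-k)$-cube, of minimal dimension, denoted $\min(B_\epsilon)$, given by $c(\epsilon)$. Generating cofibrations. $I_+$ is the set of inclusions $i_\epsilon:B_\epsilon\setminus\{\min(B_\epsilon)\}\hookrightarrow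 B_\epsilon$, $\epsilon\in\{0,1\}^n$. For $i:c\to d$, $\nabla_i=(\mathrm{id}_d,\mathrm{id}_d):d\sqcup_c d\to d$ is its codiagonal. $\mathrm{RLP}(I)$ (resp. $\mathrm{LLP}(I)$) is the class of morphisms with the right (resp. left) lifting property against $I$. $P$ is cofibrant if $\varnothing\to P$ is in $\mathrm{LLP}(\mathrm{RLP}(I))$; trivial fibrations are the elements of $\mathrm{RLP}(I)$. Euclidean. A morphism $\alpha:P\to Q$ is a local embedding if for all distinct cubes $a,b\in P$, if there are a morphism $w$ of $\square$ and a cube $c$ of $P$ with $a\to_w c$ and $b\to_w c$, then $\alpha(a)\neq\alpha(b)$. $P$ is ($n$-)euclidean if for every cube $c$ of $P$ there are a euclidean brick $B_\epsilon$ and a surjective local embedding $B_\epsilon\to\uparrow c$. Blowup. For $\epsilon\in\{0,1\}^n$ let $D_\epsilon$ be the set of $w\in\{+,-,0,1\}^n$ such that $w_i=0$ iff $\epsilon_i=0$. Let $p:\{+,-,0,1\}^n\to\{0,1\}^n$ be the componentwise map sending $0,+,-$ to $0$ and $1$ to $1$. Let $\iota_-,\iota_+:V_0\hookrightarrow V_1$ be the inclusions as first and second edge respectively. For $w\in D_\epsilon$, $\iota_w:B_{p(w)}\to B_\epsilon$ is the inclusion induced by applying $\iota_{w_i}$ in the coordinates $i$ with $w_i\in\{+,-\}$ and the identity elsewhere. The elements $w\in D_\epsilon$ correspond bijectively to the cubes of $B_\epsilon$ via $w\mapsto\iota_w(\min(B_{p(w)}))$ (with $\epsilon$ corresponding to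 $\min(B_\epsilon)$), and $w\to_g\epsilon$ means that the corresponding cubes are so related in $B_\epsilon$. The ($n$-)blowup $\tilde P$ of $P$ is the relational precubical set with $$\tilde P(k)=\bigsqcup_{\epsilon\text{ of codimension }n-k}\mathrm{Hom}(B_\epsilon,P),$$ $$\tilde P(g)=\{(f\circ\iota_w,f)\mid f:B_\epsilon\to P,\ w\in D_\epsilon,\ w\to_g\epsilon\},$$ and the blowup map $\beta_P:\tilde P\to P$ is $\beta_P(f)=f(\min(\mathrm{dom}(f)))$. *)

(* Defs.v *)
Set Warnings "-notation-overridden".
From HB Require Import structures.
From mathcomp Require Import all_boot generic_quotient boolp.

Set Implicit Arguments.
Unset Strict Implicit.
Unset Printing Implicit Defensive.

Local Open Scope quotient_scope.

(** * The cube category *)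

(* The letter [(eta, i)] stands for the generator d^eta_{m,i} : m -> m.+1, with
   eta = false for - and eta = true for +. A path of generators is written with
   the letter that is applied first at the head. *)
Definition letter := (bool * nat)%type.

Fixpoint path_ok (m : nat) (s : seq letter) (n : nat) : bool :=
  if s is x :: s' then (x.2 <= m) && path_ok m.+1 s' n else m == n.

(* Morphisms m -> n of the free category on the generators. *)
Definition cpath (m n : nat) := {s : seq letter | path_ok m s n}.

(* The congruence generated by d^eta'_j o d^eta_i = d^eta_i o d^eta'_{j-1} for
   i < j. A swap preserves [path_ok] in both directions, so the intermediate
   words of a chain between two paths m -> n are again paths m -> n. *)
Inductive word_eq : seq letter -> seq letter -> Prop :=
| word_refl s : word_eq s s
| word_sym s t : word_eq s t -> word_eq t s
| word_trans s t u : word_eq s t -> word_eq t u -> word_eq s u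
| word_swap s t eta eta' i j : i < j ->
    word_eq (s ++ (eta, i) :: (eta', j) :: t)
            (s ++ (eta', j.-1) :: (eta, i) :: t).

Lemma path_ok_cat m s t p :
  path_ok m (s ++ t) p = path_ok m s (m + size s) && path_ok (m + size s) t p.
Proof.
elim: s m => [|x s IH] m /=; first by rewrite addn0 eqxx.
by rewrite IH addSnnS andbA.
Qed.

Lemma path_ok_size m s n : path_ok m s n -> n = m + size s.
Proof.
elim: s m => [|x s IH] m /=; first by move/eqP=> ->; rewrite addn0.
by case/andP=> _ /IH ->; rewrite addSnnS.
Qed.

Lemma word_eq_path_ok s t m n : word_eq s t -> path_ok m s n = path_ok m t n.
Proof.
move=> E; elim: E m n => {s t} //.
- by move=> s t u _ IH1 _ IH2 m n; rewrite IH1 IH2.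
- move=> s t eta eta' i j ij m n; rewrite !path_ok_cat; congr (_ && _) => /=.
  rewrite !andbA; congr (_ && _); move: ij; case: j => // j; rewrite !ltnS /=.
  move=> ij; apply/andP/andP=> [][H1 H2]; split => //.
    exact: leq_trans (leq_trans ij H2) (leqnSn _).
  exact: leq_trans ij H1.
Qed.

Section CubeHom.
Variables m n : nat.

Definition path_eq : rel (cpath m n) :=
  fun s t => `[< word_eq (val s) (val t) >].

Lemma path_eq_refl : reflexive path_eq.
Proof. by move=> s; apply/asboolP; constructor. Qed.

Lemma path_eq_sym : symmetric path_eq.
Proof. by move=> s t; apply/asboolP/asboolP; apply: word_sym. Qed.

Lemma path_eq_trans : transitive path_eq.
Proof.
by move=> s t u /asboolP E /asboolP F; apply/asboolP; exact: word_trans F.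
Qed.

Canonical path_equiv := EquivRel path_eq path_eq_refl path_eq_sym path_eq_trans.

Definition cube_hom := {eq_quot path_equiv}.

Definition cube_class (s : cpath m n) : cube_hom := \pi s.

Lemma cube_classP s t :
  word_eq (val s) (val t) <-> cube_class s = cube_class t.
Proof.
split; first by move=> E; apply/eqquotP/asboolP.
by move/eqquotP/asboolP.
Qed.

Lemma cube_homP (f : cube_hom) : exists s, f = cube_class s.
Proof. by exists (repr f); rewrite /cube_class reprK. Qed.

End CubeHom.

Lemma word_eq_cat s s' t t' :
  word_eq s s' -> word_eq t t' -> word_eq (s ++ t) (s' ++ t').
Proof.
move=> E F; apply: (@word_trans _ (s' ++ t)).
  elim: E => {s s'}.
  - by move=> s; constructor.
  - by move=> s s' _ IH; apply: word_sym.
  - by move=> s1 s2 s3 _ IH1 _ IH2; apply: word_trans IH1 IH2.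
  - by move=> u v eta eta' i j ij; rewrite -!catA /=; constructor.
elim: F => {t t'}.
- by move=> t; constructor.
- by move=> t t' _ IH; apply: word_sym.
- by move=> s1 s2 s3 _ IH1 _ IH2; apply: word_trans IH1 IH2.
- by move=> u v eta eta' i j ij; rewrite !catA; constructor.
Qed.

Lemma path_id_ok m : path_ok m [::] m.
Proof. exact: eqxx. Qed.

Definition cube_id m : cube_hom m m := cube_class (Sub [::] (path_id_ok m)).

Lemma face_ok n eta (i : 'I_n.+1) : path_ok n [:: (eta, val i)] n.+1.
Proof. by rewrite /= eqxx andbT -ltnS. Qed.

Definition cube_face n (eta : bool) (i : 'I_n.+1) : cube_hom n n.+1 :=
  cube_class (Sub [:: (eta, val i)] (face_ok eta i)).

Lemma path_comp_ok m n p (t : cpath n p) (s : cpath m n) :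
  path_ok m (val s ++ val t) p.
Proof.
case: s t => s sP [t tP] /=; rewrite path_ok_cat.
by rewrite -(path_ok_size sP) sP tP.
Qed.

Definition path_comp m n p (t : cpath n p) (s : cpath m n) : cpath m p :=
  Sub (val s ++ val t) (path_comp_ok t s).

Definition cube_comp m n p (g : cube_hom n p) (f : cube_hom m n) :
  cube_hom m p := cube_class (path_comp (repr g) (repr f)).

Notation "g ∘ f" := (cube_comp g f) (at level 40, left associativity).

Lemma repr_class m n (s : cpath m n) :
  word_eq (val (repr (cube_class s))) (val s).
Proof. by apply/cube_classP; rewrite /cube_class reprK. Qed.

Lemma cube_comp_class m n p (t : cpath n p) (s : cpath m n) :
  cube_class t ∘ cube_class s = cube_class (path_comp t s).
Proof. by apply/cube_classP/word_eq_cat; exact: repr_class. Qed.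

Lemma cube_comp_idl m n (f : cube_hom m n) : cube_id n ∘ f = f.
Proof.
have [s ->] := cube_homP f; rewrite /cube_id cube_comp_class.
by apply/cube_classP; rewrite /= cats0; constructor.
Qed.

Lemma cube_comp_idr m n (f : cube_hom m n) : f ∘ cube_id m = f.
Proof.
have [s ->] := cube_homP f; rewrite /cube_id cube_comp_class.
by apply/cube_classP; constructor.
Qed.

Lemma cube_compA m n p q (h : cube_hom p q) (g : cube_hom n p)
  (f : cube_hom m n) : h ∘ (g ∘ f) = h ∘ g ∘ f.
Proof.
have [s ->] := cube_homP f; have [t ->] := cube_homP g.
have [u ->] := cube_homP h; rewrite !cube_comp_class.
by apply/cube_classP; rewrite /= catA; constructor.
Qed.

Lemma cube_face_face n eta eta' (i : 'I_n.+1) (j : 'I_n.+2)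
    (i' : 'I_n.+2) (j' : 'I_n.+1) :
  i < j -> i' = i :> nat -> j' = j.-1 :> nat ->
  cube_face eta' j ∘ cube_face eta i = cube_face eta i' ∘ cube_face eta' j'.
Proof.
move=> ij Ei Ej; rewrite !cube_comp_class; apply/cube_classP => /=.
by rewrite Ei Ej; apply: (@word_swap [::] [::]).
Qed.

(* The monoidal structure of the cube category: m + n on objects and
   f ⊗ g = (id ⊗ g) o (f ⊗ id) on morphisms, where d_{m,i} ⊗ id_k = d_{m+k,i}
   and id_k ⊗ d_{m,i} = d_{k+m,k+i}. *)
Definition shift (k : nat) (s : seq letter) := [seq (x.1, k + x.2) | x <- s].

Lemma path_tens_ok m n m' n' (s : cpath m n) (t : cpath m' n') :
  path_ok (m + m') (val s ++ shift n (val t)) (n + n').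
Proof.
case: s t => s sP [t tP] /=; rewrite path_ok_cat; apply/andP; split.
  move: sP; rewrite (addnAC m m') => sP; rewrite -(path_ok_size sP).
  elim: s m sP => [|x s IH] m /=; first by move/eqP->.
  by case/andP=> xm sP; rewrite (leq_trans xm) ?leq_addr //= -addSn IH.
rewrite addnAC -(path_ok_size sP).
elim: t m' tP => [|x t IH] m' /=; first by move/eqP->.
by case/andP=> xm tP; rewrite leq_add2l xm /= -addnS IH.
Qed.

Definition path_tens m n m' n' (s : cpath m n) (t : cpath m' n') :
  cpath (m + m') (n + n') :=
  Sub (val s ++ shift n (val t)) (path_tens_ok s t).

Definition cube_tens m n m' n' (f : cube_hom m n) (g : cube_hom m' n') :
  cube_hom (m + m') (n + n') := cube_class (path_tens (repr f) (repr g)).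

Lemma word_eq_shift k s t : word_eq s t -> word_eq (shift k s) (shift k t).
Proof.
elim=> {s t}.
- by move=> s; constructor.
- by move=> s t _ IH; apply: word_sym.
- by move=> s t u _ IH1 _ IH2; apply: word_trans IH1 IH2.
move=> s t eta eta' i [//|j] ij; rewrite /shift !map_cat /=.
have -> : k + j = (k + j.+1).-1 by rewrite addnS.
by constructor; rewrite ltn_add2l.
Qed.

Lemma cube_tens_class m n m' n' (s : cpath m n) (t : cpath m' n') :
  cube_tens (cube_class s) (cube_class t) = cube_class (path_tens s t).
Proof.
apply/cube_classP/word_eq_cat; first exact: repr_class.
by apply: word_eq_shift; exact: repr_class.
Qed.

Lemma cube_tens_facel m n eta (k : 'I_m.+1) (k' : 'I_(m + n).+1) :
  k' = k :> nat ->
  cube_tens (cube_face eta k) (cube_id n) = cube_face eta k'.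
Proof.
by move=> E; rewrite cube_tens_class; apply/cube_classP; rewrite /= E; constructor.
Qed.

Lemma cube_tens_facer m n eta (k : 'I_n.+1) (k' : 'I_(m + n).+1) :
  k' = m + k :> nat ->
  cube_tens (cube_id m) (cube_face eta k) =
    ecast p (cube_hom (m + n) p) (esym (addnS m n)) (cube_face eta k').
Proof.
move=> E; have cast p q (Epq : p = q) (s : cpath (m + n) p) :
    exists2 t, ecast p (cube_hom (m + n) p) Epq (cube_class s) = cube_class t
    & val t = val s by case: q / Epq; exists s.
have [t] := cast _ _ (esym (addnS m n)) (exist (fun s => path_ok (m + n) s (m + n).+1) _ (face_ok eta k')).
rewrite /cube_face => -> tE; rewrite cube_tens_class; apply/cube_classP.
by rewrite tE /= E; constructor.
Qed.

Lemma cube_tens_id m n : cube_tens (cube_id m) (cube_id n) = cube_id (m + n).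
Proof. by rewrite cube_tens_class; apply/cube_classP; constructor. Qed.

Lemma word_eq_interchange m n s t : path_ok m s n ->
  word_eq (s ++ shift n t) (shift m t ++ s).
Proof.
elim: s m => [|[eta i] s IH] m /=.
  by move/eqP->; rewrite cats0; constructor.
case/andP=> im /IH E.
apply: (@word_trans _ ([:: (eta, i)] ++ (shift m.+1 t ++ s))).
  by apply: (@word_eq_cat [:: _] [:: _]) E; constructor.
rewrite -[_ :: s]/([:: (eta, i)] ++ s) !catA; apply: word_eq_cat; last first.
  by constructor.
elim: t {E IH} => [|[eta' j] t IHt] /=; first by constructor.
apply: (@word_trans _ ([:: (eta', m + j); (eta, i)] ++ shift m.+1 t)).
  rewrite -[m + j]/((m.+1 + j).-1).
  by apply: (@word_swap [::]); rewrite addSn ltnS (leq_trans im) ?leq_addr.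
by apply: (@word_eq_cat [:: _] [:: _]) IHt; constructor.
Qed.

Lemma cube_tens_comp m n p m' n' p' (g : cube_hom n p) (f : cube_hom m n)
    (g' : cube_hom n' p') (f' : cube_hom m' n') :
  cube_tens (g ∘ f) (g' ∘ f') = cube_tens g g' ∘ cube_tens f f'.
Proof.
have [s ->] := cube_homP f; have [s' ->] := cube_homP f'.
have [t ->] := cube_homP g; have [t' ->] := cube_homP g'.
rewrite !(cube_comp_class, cube_tens_class); apply/cube_classP => /=.
rewrite /shift map_cat -!/(shift _ _) -!catA.
apply: word_eq_cat; first by constructor.
rewrite !catA; apply: word_eq_cat; last by constructor.
exact: word_eq_interchange (valP t).
Qed.

(** * Relational precubical sets *)

(* Lax functors from the opposite of the cube category to Rel; [rel P f a b]
   is a ->_f b. *)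
Record rpcset := RPCSet {
  cubes :> nat -> Type;
  prel : forall m n, cube_hom m n -> cubes n -> cubes m -> Prop;
  prel_id : forall n (x : cubes n), prel (cube_id n) x x;
  prel_comp : forall m n p (f : cube_hom n p) (g : cube_hom m n) a b e,
    prel f a b -> prel g b e -> prel (f ∘ g) a e }.

Arguments prel P {m n} f a b : rename.

Record rpcmor (P Q : rpcset) := RPCMor {
  mor_fun :> forall n, P n -> Q n;
  mor_rel : forall m n (f : cube_hom m n) (a : P n) (b : P m),
    prel P f a b -> prel Q f (mor_fun a) (mor_fun b) }.

Lemma rpcmor_ext P Q (f g : rpcmor P Q) :
  (forall n (x : P n), f n x = g n x) -> f = g.
Proof.
case: f g => [f fP] [g gP] /= E.
have {}E : f = g by apply/functional_extensionality_dep=> n; apply/funext=> x.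
by subst g; congr RPCMor; exact: Prop_irrelevance.
Qed.

Definition mor_id P : rpcmor P P :=
  @RPCMor P P (fun _ x => x) (fun _ _ _ _ _ h => h).

Definition mor_comp P Q R (g : rpcmor Q R) (f : rpcmor P Q) : rpcmor P R :=
  @RPCMor P R (fun n x => g n (f n x))
    (fun _ _ _ _ _ h => mor_rel g (mor_rel f h)).

Notation "g \c f" := (mor_comp g f) (at level 40, left associativity).

Definition empty_rpcset : rpcset :=
  @RPCSet (fun _ => void) (fun _ _ _ _ _ => False)
    (fun _ x => match x with end) (fun _ _ _ _ _ _ _ _ h _ => h).

Definition from_empty P : rpcmor empty_rpcset P :=
  @RPCMor empty_rpcset P (fun _ x => match x with end)
    (fun _ _ _ _ _ h => match h with end).

Section Restriction.
Variables (P : rpcset) (A : forall n, P n -> Prop).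

Definition restr_rel m n (f : cube_hom m n)
  (a : {x : P n | A x}) (b : {x : P m | A x}) : Prop :=
  prel P f (sval a) (sval b).

Lemma restr_id n (x : {x : P n | A x}) : restr_rel (cube_id n) x x.
Proof. exact: prel_id. Qed.

Lemma restr_comp m n p (f : cube_hom n p) (g : cube_hom m n) a b e :
  restr_rel f a b -> restr_rel g b e -> restr_rel (f ∘ g) a e.
Proof. exact: prel_comp. Qed.

Definition restr : rpcset := RPCSet restr_id restr_comp.

Definition restr_incl : rpcmor restr P :=
  @RPCMor restr P (fun n x => sval x) (fun _ _ _ _ _ h => h).

End Restriction.

(** * Graphs and tensor products *)

Record graph := Graph {
  vertex : Type; edge : Type; source : edge -> vertex; target : edge -> vertex }.

Inductive graph_cube (G : graph) : nat -> Type :=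
| GVertex (v : vertex G) : graph_cube G 0
| GEdge (e : edge G) : graph_cube G 1.

Inductive graph_rel (G : graph) : forall m n,
    cube_hom m n -> graph_cube G n -> graph_cube G m -> Prop :=
| GRelId n (x : graph_cube G n) : graph_rel (cube_id n) x x
| GRelSource e :
    graph_rel (cube_face false ord0) (GEdge e) (GVertex (source e))
| GRelTarget e :
    graph_rel (cube_face true ord0) (GEdge e) (GVertex (target e)).

Lemma graph_rel_vertex (G : graph) m n (g : cube_hom m n)
    (x : graph_cube G n) (y : graph_cube G m) :
  graph_rel g x y ->
  match x in graph_cube _ k return cube_hom m k -> Prop with
  | GVertex v => fun g => forall p (f : cube_hom 0 p) (a : graph_cube G p),
      graph_rel f a (GVertex v) -> graph_rel (f ∘ g) a y
  | GEdge _ => fun _ => True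
  end g.
Proof.
case=> {m n g x y} //= n [v|//] p f a.
by rewrite cube_comp_idr.
Qed.

Lemma graph_rel_comp (G : graph) m n p (f : cube_hom n p) (g : cube_hom m n)
    (a : graph_cube G p) b e :
  graph_rel f a b -> graph_rel g b e -> graph_rel (f ∘ g) a e.
Proof.
move=> ab; case: _ _ _ _ _ / ab g e => {n p f a b}.
- by move=> n x g e xe; rewrite cube_comp_idl.
- by move=> e g x /graph_rel_vertex; apply; constructor.
- by move=> e g x /graph_rel_vertex; apply; constructor.
Qed.

Definition rpcset_of_graph (G : graph) : rpcset :=
  RPCSet (@GRelId G) (@graph_rel_comp G).

Inductive tens_cube (P Q : rpcset) : nat -> Type :=
| TCube i j (x : P i) (y : Q j) : tens_cube P Q (i + j).

(* By [cube_tens_facel] and [cube_tens_facer], the faces in the directions of x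
   are taken on x and the faces in the directions of y are taken on y. *)
Inductive tens_rel (P Q : rpcset) : forall m n,
    cube_hom m n -> tens_cube P Q n -> tens_cube P Q m -> Prop :=
| TRel i i' j j' (f : cube_hom i' i) (g : cube_hom j' j) x x' y y' :
    prel P f x x' -> prel Q g y y' ->
    tens_rel (cube_tens f g) (TCube x y) (TCube x' y').

Lemma tens_rel_id (P Q : rpcset) n (z : tens_cube P Q n) : tens_rel (cube_id n) z z.
Proof.
by case: z => i j x y; rewrite -cube_tens_id; constructor; apply: prel_id.
Qed.

Lemma tens_rel_inv (P Q : rpcset) m n (g : cube_hom m n) (z : tens_cube P Q n)
    (t : tens_cube P Q m) :
  tens_rel g z t ->
  match z in tens_cube _ _ k return cube_hom m k -> Prop with
  | TCube i j x y => fun g =>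
      forall p (f : cube_hom (i + j) p) (a : tens_cube P Q p),
      (exists i1 j1 (h : cube_hom i i1) (l : cube_hom j j1) x1 y1
        (E : i1 + j1 = p),
        [/\ prel P h x1 x, prel Q l y1 y,
            f = ecast k (cube_hom (i + j) k) E (cube_tens h l)
          & a = ecast k (tens_cube P Q k) E (TCube x1 y1)]) ->
      tens_rel (f ∘ g) a t
  end g.
Proof.
case=> i i' j j' f g' x x' y y' fx gy p k a.
case=> i1 [j1] [h] [l] [x1] [y1] [E [hx ly -> ->]].
case: _ / E; rewrite -cube_tens_comp.
by constructor; [apply: prel_comp fx|apply: prel_comp gy].
Qed.

Lemma tens_rel_comp (P Q : rpcset) m n p (f : cube_hom n p) (g : cube_hom m n)
    (a : tens_cube P Q p) b e :
  tens_rel f a b -> tens_rel g b e -> tens_rel (f ∘ g) a e.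
Proof.
move=> ab; case: _ _ _ _ _ / ab g e.
move=> i i' j j' h l x x' y y' hx ly g e /tens_rel_inv; apply.
by exists i, j, h, l, x, y, erefl.
Qed.

Definition tens (P Q : rpcset) : rpcset :=
  RPCSet (@tens_rel_id P Q) (@tens_rel_comp P Q).

Definition tens_mor_fun P P' Q Q' (f : rpcmor P P') (g : rpcmor Q Q') n
    (z : tens P Q n) : tens P' Q' n :=
  match z with TCube _ _ x y => TCube (f _ x) (g _ y) end.

Lemma tens_mor_rel P P' Q Q' (f : rpcmor P P') (g : rpcmor Q Q') m n
    (h : cube_hom m n) (a : tens P Q n) (b : tens P Q m) :
  prel _ h a b -> prel _ h (tens_mor_fun f g a) (tens_mor_fun f g b).
Proof. by case=> * /=; constructor; apply: mor_rel. Qed.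

Definition tens_mor P P' Q Q' (f : rpcmor P P') (g : rpcmor Q Q') :
  rpcmor (tens P Q) (tens P' Q') := RPCMor (@tens_mor_rel _ _ _ _ f g).

Lemma tens_mor_comp P P' P'' Q Q' Q'' (f : rpcmor P P') (f' : rpcmor P' P'')
    (g : rpcmor Q Q') (g' : rpcmor Q' Q'') :
  tens_mor f' g' \c tens_mor f g = tens_mor (f' \c f) (g' \c g).
Proof. by apply: rpcmor_ext => n []. Qed.

Lemma tens_mor_id P Q : tens_mor (mor_id P) (mor_id Q) = mor_id (tens P Q).
Proof. by apply: rpcmor_ext => n []. Qed.

(** * Upward neighborhoods, local embeddings *)

Record up_cube (P : rpcset) k (c : P k) (n : nat) := UpCube {
  up_base : P n;
  up_mor : cube_hom k n;
  up_baseP : prel P up_mor up_base c }.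

Definition up_rel (P : rpcset) k (c : P k) m n (g : cube_hom m n)
    (a : up_cube c n) (b : up_cube c m) : Prop :=
  prel P g (up_base a) (up_base b) /\ up_mor a = g ∘ up_mor b.

Lemma up_rel_id (P : rpcset) k (c : P k) n (x : up_cube c n) : up_rel (cube_id n) x x.
Proof. by split; [apply: prel_id|rewrite cube_comp_idl]. Qed.

Lemma up_rel_comp (P : rpcset) k (c : P k) m n p (f : cube_hom n p) (g : cube_hom m n)
    (a : up_cube c p) b e :
  up_rel f a b -> up_rel g b e -> up_rel (f ∘ g) a e.
Proof.
move=> [ab Ea] [be Eb]; split; first exact: prel_comp be.
by rewrite Ea Eb cube_compA.
Qed.

Definition up (P : rpcset) k (c : P k) : rpcset :=
  RPCSet (@up_rel_id P k c) (@up_rel_comp P k c).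

Definition up_self (P : rpcset) k (c : P k) : up c k :=
  UpCube (prel_id c).

Lemma up_cube_ext (P : rpcset) k (c : P k) n (x y : up c n) :
  up_base x = up_base y -> up_mor x = up_mor y -> x = y.
Proof.
case: x y => [a f af] [b g bg] /= E F; subst b g; congr UpCube.
exact: Prop_irrelevance.
Qed.

Section UpMap.
Variables (P Q : rpcset) (f : rpcmor P Q) (k : nat) (c : P k).
Variables (l : nat) (e : Q l) (g : cube_hom l k) (fce : prel Q g (f k c) e).

Definition up_map_fun n (x : up c n) : up e n :=
  UpCube (prel_comp (mor_rel f (up_baseP x)) fce).

Lemma up_map_rel m n (h : cube_hom m n) (a : up c n) (b : up c m) :
  prel _ h a b -> prel _ h (up_map_fun a) (up_map_fun b).
Proof.
by move=> [ab Ea]; split=> /=; [apply: mor_rel|rewrite Ea cube_compA].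
Qed.

(* (d, h) |-> (f d, h o g), for a relation f c ->_g e in Q. *)
Definition up_map : rpcmor (up c) (up e) := RPCMor up_map_rel.

End UpMap.

Definition local_embedding (P Q : rpcset) (f : rpcmor P Q) : Prop :=
  forall n (a b : P n), a <> b ->
    (exists m (w : cube_hom m n) (c : P m), prel P w a c /\ prel P w b c) ->
    f n a <> f n b.

Definition mor_surjective (P Q : rpcset) (f : rpcmor P Q) : Prop :=
  forall n (y : Q n), exists x : P n, f n x = y.

(** * Euclidean bricks *)

Definition graph0 : graph :=
  @Graph bool unit (fun _ => false) (fun _ => true).

(* The central vertex is [None], the outer ones are [Some false] and
   [Some true]; [false] is the first edge and [true] the second one. *)
Definition graph1 : graph :=
  @Graph (option bool) bool
    (fun e => if e then None else Some false)
    (fun e => if e then Some true else None).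

Definition V (b : bool) : rpcset :=
  rpcset_of_graph (if b then graph1 else graph0).

(* The dimension of [center b], i.e. 1 - b. *)
Definition vdim (b : bool) : nat := if b then 0 else 1.

Definition center (b : bool) : V b (vdim b) :=
  match b with
  | false => @GEdge graph0 tt
  | true => @GVertex graph1 None
  end.

Definition point : rpcset :=
  rpcset_of_graph (@Graph unit void (fun _ => tt) (fun _ => tt)).

Fixpoint Vtens (e : seq bool) : rpcset :=
  if e is b :: e' then tens (V b) (Vtens e') else point.

Fixpoint bdim (e : seq bool) : nat :=
  if e is b :: e' then vdim b + bdim e' else 0.

Fixpoint centers (e : seq bool) : Vtens e (bdim e) :=
  match e with
  | [::] => @GVertex (@Graph unit void (fun _ => tt) (fun _ => tt)) tt
  | b :: e' => TCube (center b) (centers e')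
  end.

Definition brick (e : seq bool) : rpcset := up (centers e).

Definition bmin (e : seq bool) : brick e (bdim e) := up_self (centers e).

Definition codim (e : seq bool) : nat := count id e.

Lemma codim_bdim e : codim e + bdim e = size e.
Proof. by elim: e => //= -[] e /= <-; rewrite ?addnS. Qed.

Definition euclidean (n : nat) (P : rpcset) : Prop :=
  forall k (c : P k), exists (e : n.-tuple bool) (f : rpcmor (brick e) (up c)),
    mor_surjective f /\ local_embedding f.

(** * Lifting properties and generating cofibrations *)

Definition mor_class := forall P Q : rpcset, rpcmor P Q -> Prop.

Definition has_lifting A B X Y (i : rpcmor A B) (p : rpcmor X Y) : Prop :=
  forall (u : rpcmor A X) (v : rpcmor B Y), p \c u = v \c i ->
    exists h : rpcmor B X, h \c i = u /\ p \c h = v.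

Definition RLP (I : mor_class) : mor_class :=
  fun X Y p => forall A B (i : rpcmor A B), I A B i -> has_lifting i p.

Definition LLP (I : mor_class) : mor_class :=
  fun A B i => forall X Y (p : rpcmor X Y), I X Y p -> has_lifting i p.

Definition is_pushout C D E X (f : rpcmor C D) (g : rpcmor C E)
    (jD : rpcmor D X) (jE : rpcmor E X) : Prop :=
  jD \c f = jE \c g /\
  forall Y (u : rpcmor D Y) (v : rpcmor E Y), u \c f = v \c g ->
    exists! h : rpcmor X Y, h \c jD = u /\ h \c jE = v.

Definition is_codiagonal C D X (i : rpcmor C D) (nabla : rpcmor X D) : Prop :=
  exists j1 j2 : rpcmor D X,
    [/\ is_pushout i i j1 j2, nabla \c j1 = mor_id D & nabla \c j2 = mor_id D].

Definition brick_boundary (e : seq bool) : rpcset :=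
  restr (fun k (x : brick e k) => Tagged (brick e) x <> Tagged (brick e) (bmin e)).

Definition brick_incl (e : seq bool) : rpcmor (brick_boundary e) (brick e) :=
  restr_incl _.

(* I_+ together with the codiagonals of its elements; as pushouts are defined
   up to isomorphism, all the representatives of a codiagonal are included. *)
Inductive gen_cof (n : nat) : mor_class :=
| GenIncl (e : n.-tuple bool) : gen_cof n (brick_incl e)
| GenCodiag (e : n.-tuple bool) X (nabla : rpcmor X (brick e)) :
    is_codiagonal (brick_incl e) nabla -> gen_cof n nabla.

(** * The model structure *)

(* Only the three classes of maps are recorded: cofibrant objects, trivial
   fibrations and cofibrant replacements do not involve the axioms. *)
Record model_classes := ModelClasses {
  cofibration : mor_class;
  weak_equivalence : mor_class;
  fibration : mor_class }.

Definition cofibrant (M : model_classes) (P : rpcset) : Prop :=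
  cofibration M (from_empty P).

Definition trivial_fibration (M : model_classes) P Q (f : rpcmor P Q) : Prop :=
  fibration M f /\ weak_equivalence M f.

Definition cofibrant_replacement (M : model_classes) P Q (f : rpcmor Q P) :=
  cofibrant M Q /\ trivial_fibration M f.

Definition euclidean_model (n : nat) : model_classes := {|
  cofibration := LLP (RLP (@gen_cof n));
  weak_equivalence := RLP (@gen_cof n);
  fibration := fun _ _ _ => True |}.

(** * The blowup *)

Inductive sgn := Minus | Plus | Zero | One.

(* The map sending 0, +, - to 0 and 1 to 1. *)
Definition sgn_p (w : sgn) : bool := if w is One then true else false.

(* D_epsilon, the set of w such that w_i = 0 iff epsilon_i = 0, is the fibre
   over epsilon of the componentwise extension of this map. *)
Definition sgn_eps (w : sgn) : bool := if w is Zero then false else true.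

Lemma sgn_epsP n (w : n.-tuple sgn) (e : n.-tuple bool) :
  (forall i, tnth w i = Zero <-> tnth e i = false) <-> e = map_tuple sgn_eps w.
Proof.
split=> [wD|-> i]; last by rewrite tnth_map; case: (tnth w i).
apply: eq_from_tnth => i; rewrite tnth_map; move: (wD i).
by case: (tnth w i) (tnth e i) => -[] // [] // H1 H2; first [have := H1 erefl|have := H2 erefl].
Qed.

Definition graph_edge_fun (e : bool) n (x : V false n) : V true n :=
  match x with
  | GVertex v => @GVertex graph1 (if v then @target graph1 e else @source graph1 e)
  | GEdge _ => @GEdge graph1 e
  end.

Lemma graph_edge_rel (e : bool) m n (f : cube_hom m n) (a : V false n)
    (b : V false m) :
  prel _ f a b -> prel _ f (graph_edge_fun e a) (graph_edge_fun e b).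
Proof.
case=> [k x|y|y] /=; first exact: GRelId.
  exact: (@GRelSource graph1 e).
exact: (@GRelTarget graph1 e).
Qed.

(* The inclusion of V_0 in V_1 as the first (e = false) or second (e = true)
   edge. *)
Definition graph_edge (e : bool) : rpcmor (V false) (V true) :=
  RPCMor (@graph_edge_rel e).

Definition iota1 (w : sgn) : rpcmor (V (sgn_p w)) (V (sgn_eps w)) :=
  match w with
  | Minus => graph_edge false
  | Plus => graph_edge true
  | Zero => mor_id (V false)
  | One => mor_id (V true)
  end.

(* The first edge has p_1 as its front face, the second one as its back face. *)
Definition iota1_face (w : sgn) :
    cube_hom (vdim (sgn_eps w)) (vdim (sgn_p w)) :=
  match w with
  | Minus => cube_face true ord0
  | Plus => cube_face false ord0
  | Zero => cube_id 1
  | One => cube_id 0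
  end.

Lemma iota1_center (w : sgn) :
  prel _ (iota1_face w) (iota1 w _ (center (sgn_p w))) (center (sgn_eps w)).
Proof.
case: w => /=; [|exact: (@GRelSource graph1 true)|exact: GRelId|exact: GRelId].
exact: (@GRelTarget graph1 false).
Qed.

Fixpoint Viota (w : seq sgn) : rpcmor (Vtens (map sgn_p w)) (Vtens (map sgn_eps w)) :=
  match w with
  | [::] => mor_id point
  | a :: w' => tens_mor (iota1 a) (Viota w')
  end.

Fixpoint Viota_face (w : seq sgn) :
    cube_hom (bdim (map sgn_eps w)) (bdim (map sgn_p w)) :=
  match w with
  | [::] => cube_id 0
  | a :: w' => cube_tens (iota1_face a) (Viota_face w')
  end.

Lemma Viota_centers (w : seq sgn) :
  prel _ (Viota_face w) (Viota w _ (centers (map sgn_p w)))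
    (centers (map sgn_eps w)).
Proof.
elim: w => [|a w IH] /=; first exact: GRelId.
by constructor; first exact: iota1_center.
Qed.

Definition iota (w : seq sgn) :
    rpcmor (brick (map sgn_p w)) (brick (map sgn_eps w)) :=
  up_map (Viota_centers w).

(* [bmor_iota m] says that m is one of the inclusions [iota w], see
   [bmor_iotaP]. The recursion on the two lists avoids transports when such
   inclusions are composed, which is needed for the blowup to be lax. *)
Definition vmor_iota (a b : bool) :
    rpcmor (V a) (V b) -> cube_hom (vdim b) (vdim a) -> Prop :=
  match a, b with
  | false, false => fun m h => m = mor_id (V false) /\ h = cube_id 1
  | true, true => fun m h => m = mor_id (V true) /\ h = cube_id 0
  | false, true => fun m h =>
      exists e, m = graph_edge e /\ h = cube_face (~~ e) ord0
  | true, false => fun _ _ => False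
  end.

Fixpoint tmor_iota (s t : seq bool) :
    rpcmor (Vtens s) (Vtens t) -> cube_hom (bdim t) (bdim s) -> Prop :=
  match s, t with
  | [::], [::] => fun M g => M = mor_id point /\ g = cube_id 0
  | a :: s', b :: t' => fun M g => exists m h M' g',
      [/\ @vmor_iota a b m h, @tmor_iota s' t' M' g',
          M = tens_mor m M' & g = cube_tens h g']
  | _, _ => fun _ _ => False
  end.

Inductive tmor_iota_spec : forall s t : seq bool,
    rpcmor (Vtens s) (Vtens t) -> cube_hom (bdim t) (bdim s) -> Prop :=
| TmorIota (w : seq sgn) : tmor_iota_spec (Viota w) (Viota_face w).

Lemma tmor_iotaP s t (M : rpcmor (Vtens s) (Vtens t)) g :
  tmor_iota M g -> tmor_iota_spec M g.
Proof.
elim: s t M g => [|a s IH] [|b t] M g //=.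
  by case=> -> ->; exact: (TmorIota [::]).
case=> m [h] [M'] [g'] [mh /IH Mg' -> ->].
case: s t M' g' / Mg' {M g IH} => w; case: a b m h mh => -[] //= m h.
- by case=> -> ->; exact: (TmorIota (One :: w)).
- case=> -[] [-> ->]; first exact: (TmorIota (Plus :: w)).
  exact: (TmorIota (Minus :: w)).
- by case=> -> ->; exact: (TmorIota (Zero :: w)).
Qed.

Lemma tmor_iota_Viota w : tmor_iota (Viota w) (Viota_face w).
Proof.
elim: w => [|a w IH] //=.
exists (iota1 a), (iota1_face a), (Viota w), (Viota_face w); split=> //.
by case: a => //=; [exists false|exists true].
Qed.

Lemma vmor_iota_comp a b c (m' : rpcmor (V a) (V b)) (m : rpcmor (V b) (V c))
    h' h : vmor_iota m' h' -> vmor_iota m h -> vmor_iota (m \c m') (h' ∘ h).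
Proof.
case: a b c m' m h' h => -[] [] //= m' m h' h.
- by case=> -> -> [-> ->]; rewrite cube_comp_idl; split=> //; apply: rpcmor_ext.
- case=> e [-> ->] [-> ->]; exists e; rewrite cube_comp_idr; split=> //.
- case=> -> -> [e] [-> ->]; exists e; rewrite cube_comp_idl; split=> //.
- by case=> -> -> [-> ->]; rewrite cube_comp_idl; split=> //; apply: rpcmor_ext.
Qed.

Lemma tmor_iota_comp r s t (M' : rpcmor (Vtens r) (Vtens s))
    (M : rpcmor (Vtens s) (Vtens t)) g' g :
  tmor_iota M' g' -> tmor_iota M g -> tmor_iota (M \c M') (g' ∘ g).
Proof.
elim: r s t M' M g' g => [|a r IH] [|b s] [|c t] M' M g' g //=.
  by case=> -> -> [-> ->]; rewrite cube_comp_idl; split=> //; apply: rpcmor_ext.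
case=> m1 [h1] [M1] [g1] [mh1 Mg1 -> ->].
case=> m2 [h2] [M2] [g2] [mh2 Mg2 -> ->].
exists (m2 \c m1), (h1 ∘ h2), (M2 \c M1), (g1 ∘ g2).
rewrite tens_mor_comp cube_tens_comp; split=> //; first exact: vmor_iota_comp.
exact: IH.
Qed.

Lemma tmor_iota_id s : tmor_iota (mor_id (Vtens s)) (cube_id (bdim s)).
Proof.
elim: s => [|a s IH] //=.
exists (mor_id (V a)), (cube_id (vdim a)), (mor_id (Vtens s)), (cube_id _).
by rewrite tens_mor_id cube_tens_id; split=> //; case: a.
Qed.

Definition bmor_iota (s t : seq bool) (m : rpcmor (brick s) (brick t)) : Prop :=
  exists (M : rpcmor (Vtens s) (Vtens t)) g
    (r : prel (Vtens t) g (M _ (centers s)) (centers t)),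
    tmor_iota M g /\ m = up_map r.

Lemma bmor_iota_comp r s t (m' : rpcmor (brick r) (brick s))
    (m : rpcmor (brick s) (brick t)) :
  bmor_iota m' -> bmor_iota m -> bmor_iota (m \c m').
Proof.
case=> M1 [g1] [r1] [Mg1 ->] [M2] [g2] [r2] [Mg2 ->].
exists (M2 \c M1), (g1 ∘ g2), (prel_comp (mor_rel M2 r1) r2).
split; first exact: tmor_iota_comp.
by apply: rpcmor_ext => n x; apply: up_cube_ext; rewrite //= cube_compA.
Qed.

Lemma bmor_iota_id s : bmor_iota (mor_id (brick s)).
Proof.
exists (mor_id _), (cube_id _), (prel_id _); split; first exact: tmor_iota_id.
by apply: rpcmor_ext => n x; apply: up_cube_ext; rewrite //= cube_comp_idr.
Qed.

Lemma bmor_iota_iota w : bmor_iota (iota w).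
Proof.
exists (Viota w), (Viota_face w), (Viota_centers w); split=> //.
exact: tmor_iota_Viota.
Qed.

Inductive bmor_iota_spec : forall s t, rpcmor (brick s) (brick t) -> Prop :=
| BmorIota (w : seq sgn) : bmor_iota_spec (iota w).

Lemma bmor_iotaP s t (m : rpcmor (brick s) (brick t)) :
  bmor_iota m <-> bmor_iota_spec m.
Proof.
split; last by case=> w; exact: bmor_iota_iota.
case=> M [g] [r] [/tmor_iotaP Mg ->]; case: Mg r => w r.
by rewrite (Prop_irrelevance r (Viota_centers w)); exact: (BmorIota w).
Qed.

Section Blowup.
Variables (n : nat) (P : rpcset).

(* By [codim_bdim], [bdim e = k] holds iff k <= n and e has codimension n - k. *)
Inductive blowup_cube : nat -> Type :=
| BCube (e : n.-tuple bool) (f : rpcmor (brick e) P) : blowup_cube (bdim e).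

Inductive blowup_rel : forall m k,
    cube_hom m k -> blowup_cube k -> blowup_cube m -> Prop :=
| BRel (w : n.-tuple sgn) (f : rpcmor (brick (map_tuple sgn_eps w)) P)
    (g : cube_hom (bdim (map_tuple sgn_eps w)) (bdim (map_tuple sgn_p w))) :
    prel (brick (map_tuple sgn_eps w)) g
      (iota w _ (bmin (map_tuple sgn_p w))) (bmin (map_tuple sgn_eps w)) ->
    blowup_rel g (@BCube (map_tuple sgn_p w) (f \c iota w)) (BCube f).

Lemma blowup_rel_iota (s t : seq bool) (m : rpcmor (brick s) (brick t)) :
  bmor_iota_spec m ->
  forall (sP : size s == n) (tP : size t == n) (f : rpcmor (brick t) P) g,
  prel (brick t) g (m _ (bmin s)) (bmin t) ->
  blowup_rel g (@BCube (Tuple sP) (f \c m)) (@BCube (Tuple tP) f).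
Proof.
case=> {s t m} w sP tP f g.
have wP : size w == n by rewrite -(size_map sgn_p).
rewrite (_ : sP = map_tupleP sgn_p (Tuple wP)); last exact: eq_irrelevance.
rewrite (_ : tP = map_tupleP sgn_eps (Tuple wP)); last exact: eq_irrelevance.
exact: (@BRel (Tuple wP)).
Qed.

Lemma blowup_relI (s t : n.-tuple bool) (f : rpcmor (brick t) P)
    (m : rpcmor (brick s) (brick t)) g :
  bmor_iota m -> prel (brick t) g (m _ (bmin s)) (bmin t) ->
  blowup_rel g (BCube (f \c m)) (BCube f).
Proof.
move=> /bmor_iotaP mi; case: s t f m mi g => s sP [t tP] f m mi g.
exact: (blowup_rel_iota mi).
Qed.

Lemma blowup_rel_id k (x : blowup_cube k) : blowup_rel (cube_id k) x x.
Proof.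
case: x => e f; have := @blowup_relI e e f (mor_id _) (cube_id _).
rewrite (_ : f \c mor_id _ = f); last exact: rpcmor_ext.
by apply; [exact: bmor_iota_id|exact: prel_id].
Qed.

Lemma blowup_rel_inv m k (g : cube_hom m k) (b : blowup_cube k)
    (c : blowup_cube m) :
  blowup_rel g b c ->
  match b in blowup_cube k return cube_hom m k -> Prop with
  | BCube e f => fun g => forall p (h : cube_hom (bdim e) p) (a : blowup_cube p),
      (exists (s : n.-tuple bool) (i : rpcmor (brick s) (brick e))
         (h' : cube_hom (bdim e) (bdim s)) (E : bdim s = p),
         [/\ bmor_iota i, prel (brick e) h' (i _ (bmin s)) (bmin e),
             h = ecast k (cube_hom (bdim e) k) E h'
           & a = ecast k (blowup_cube k) E (BCube (f \c i))]) ->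
      blowup_rel (h ∘ g) a c
  end g.
Proof.
case=> w f {}g gw p h a [s] [i] [h'] [E] [ii hi -> ->].
case: _ / E => /=.
apply: (@blowup_relI s (map_tuple sgn_eps w) f (iota w \c i)).
  by apply: bmor_iota_comp ii _; exact: bmor_iota_iota.
exact: prel_comp (mor_rel (iota w) hi) gw.
Qed.

Lemma blowup_rel_comp k l p (f : cube_hom l p) (g : cube_hom k l)
    (a : blowup_cube p) b e :
  blowup_rel f a b -> blowup_rel g b e -> blowup_rel (f ∘ g) a e.
Proof.
move=> ab; case: _ _ _ _ _ / ab g e => w {}f h hw g e /blowup_rel_inv; apply.
exists (map_tuple sgn_p w), (iota w), h, erefl; split=> //.
exact: bmor_iota_iota.
Qed.

Definition blowup : rpcset := RPCSet blowup_rel_id blowup_rel_comp.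

Definition blowup_map_fun k (x : blowup k) : P k :=
  match x with BCube e f => f _ (bmin e) end.

Lemma blowup_map_rel m k (g : cube_hom m k) (a : blowup k) (b : blowup m) :
  prel blowup g a b -> prel P g (blowup_map_fun a) (blowup_map_fun b).
Proof. by case=> w f h hw; exact: (mor_rel f hw). Qed.

Definition blowup_map : rpcmor blowup P := RPCMor blowup_map_rel.

End Blowup.

(* Main.v *)
From mathcomp Require Import all_boot generic_quotient boolp zify.
Require Import Defs.

Set Implicit Arguments.
Unset Strict Implicit.
Unset Printing Implicit Defensive.

(** Call a chart of [P] at a cube [c] a morphism [f : brick e -> P] sending the
    minimal cube to [c] such that every relation [a ->_g c] is the image of a
    relation of the brick into its minimal cube; call [P] charted if it has a
    chart at every cube. The proof compares cofibrant, euclidean and charted.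

    Charts are rigid ([chart_unique]): in a charted [P], a cube [c] determines
    the shape [e] of any morphism [brick e -> P] centred at [c], and this
    morphism itself. The reason is combinatorial. A face map m -> k of the cube
    category is a word of length k with k - m signs and m holes
    ([face_word]). A cube of a brick is determined by its own shape and by the
    word of its relation to the minimal cube ([bmor_iota_inj]); for a maximal
    cube, of dimension n, the shape is forced, and the holes of the word are the
    zeros of the shape of the brick. So the maximal cubes above [c] reveal [e]
    ([chart_shape]); the same argument at the other cubes [b] of the
    neighbourhood of [c] reveals their shapes, and then their places in the
    brick.

    By rigidity charts induce local embeddings, which makes euclidean and
    charted the same ([charted_euclidean]), and a charted [P] is the gluing of
    the bricks that map to it ([glue]). Bricks and their boundaries are charted
    by the inclusions of sub-bricks ([brick_charted], [boundary_charted]), and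
    gluing these charts a blowup is charted as well ([blowup_charted]).

    The lifting property against a codiagonal is the uniqueness of lifts, so the
    trivial fibrations are the morphisms with unique lifts against the boundary
    inclusions of bricks ([RLP_gen_cof]). Gluing, by induction on the
    codimension of bricks, then gives unique lifts of all morphisms out of
    charted objects ([lift_charted], [brick_bij]): charted objects are
    cofibrant. Conversely a morphism [f : brick e -> P] has a unique lift to the
    blowup ([sharp]), hence the blowup map is a trivial fibration
    ([blowup_map_RLP]), hence a cofibrant [P] is a retract of its charted
    blowup, and retracts of charted objects are charted. *)

(** * Words of face maps *)

(** Equalities between cubes, or between morphisms, whose dimensions or shapes
    are only propositionally equal are stated as equalities of [Tagged] pairs;
    this lemma turns them back into ordinary ones. *)
Lemma Tagged_inj (I : Type) (T_ : I -> Type) i (x y : T_ i) :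
  Tagged T_ x = Tagged T_ y -> x = y.
Proof.
have H u v (p : tag u = tag v) :
    u = v -> ecast j (T_ j) p (tagged u) = tagged v.
  by move=> E; subst v; rewrite (Prop_irrelevance p erefl).
exact: (H (Tagged T_ x) (Tagged T_ y) erefl).
Qed.

(** A face of the n-cube is encoded as a stream over {-, +, hole}, where the
    directions of the face are the holes ([None]); a generator inserts its sign
    at the position of its direction. Infinite streams make the relations of the
    cube category hold without side conditions on bounds. *)
Definition insert_face (x : letter) (l : nat -> option bool) k :=
  if k < x.2 then l k else if k == x.2 then Some x.1 else l k.-1.

Fixpoint insert_faces (s : seq letter) (l : nat -> option bool) :=
  if s is x :: s' then insert_faces s' (insert_face x l) else l.

Lemma insert_faces_ext s l l' : l =1 l' -> insert_faces s l =1 insert_faces s l'.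
Proof.
elim: s l l' => //= x s IH l l' E; apply: IH => k.
by rewrite /insert_face !E.
Qed.

Lemma insert_faces_cat s t l :
  insert_faces (s ++ t) l = insert_faces t (insert_faces s l).
Proof. by elim: s l => //= x s IH l. Qed.

Lemma insert_faces_eq s t l :
  word_eq s t -> insert_faces s l =1 insert_faces t l.
Proof.
move=> E; elim: E l => {s t} //.
- by move=> s t _ IH l k; rewrite IH.
- by move=> s t u _ IH1 _ IH2 l k; rewrite IH1 IH2.
move=> s t eta eta' i j ij l; rewrite !insert_faces_cat /=.
apply: insert_faces_ext => k; rewrite /insert_face /=.
repeat case: ifP => ?; try (exfalso; lia); try by [].
Qed.

Lemma insert_faces_tail s m n l k :
  path_ok m s n -> n <= k -> insert_faces s l k = l (k - size s).
Proof.
elim: s m l => [|[eta i] s IH] m l /=; first by rewrite subn0.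
case/andP=> im sP nk; rewrite (IH _ _ sP nk) /insert_face /=.
have E := path_ok_size sP.
do 2 (case: ifP => ?; first by exfalso; lia).
by congr l; lia.
Qed.

Lemma insert_faces_shift n t l k :
  insert_faces (shift n t) l k =
  if k < n then l k else insert_faces t (fun i => l (n + i)) (k - n).
Proof.
elim: t l k => [|[eta j] t IH] l k /=; first by case: ltnP => // nk; rewrite subnKC.
rewrite IH; case: ltnP => nk; first by rewrite /insert_face ifT //=; lia.
apply: insert_faces_ext => i; rewrite /insert_face /=.
rewrite ltn_add2l eqn_add2l; case: ifP => // ij; case: ifP => // ji.
by congr l; lia.
Qed.

(** The word of a face map [m -> n]: its letters beyond position [n] are holes,
    and it is independent of the chosen factorization into generators by
    [insert_faces_eq]. *)
Definition face_word m n (g : cube_hom m n) : nat -> option bool :=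
  insert_faces (val (repr g)) (fun _ => None).

Lemma face_word_class m n (s : cpath m n) :
  face_word (cube_class s) =1 insert_faces (val s) (fun _ => None).
Proof. exact/insert_faces_eq/repr_class. Qed.

(** Words turn the tensor product into concatenation, which is what allows
    relations in a brick to be analysed one coordinate at a time. *)
Lemma face_word_tens m n m' n' (f : cube_hom m n) (g : cube_hom m' n') k :
  face_word (cube_tens f g) k =
  if k < n then face_word f k else face_word g (k - n).
Proof.
have [s ->] := cube_homP f; have [t ->] := cube_homP g.
rewrite cube_tens_class !face_word_class /= insert_faces_cat insert_faces_shift.
case: ltnP => // _; apply: insert_faces_ext => i.
by rewrite (insert_faces_tail _ (valP s)) // leq_addr.
Qed.

Lemma cube_hom_leq m n (g : cube_hom m n) : m <= n.
Proof.
have [[s sP] _] := cube_homP g; by rewrite (path_ok_size sP) leq_addr.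
Qed.

Lemma face_word_id n : face_word (cube_id n) =1 fun _ => None.
Proof. by move=> k; rewrite face_word_class. Qed.

Lemma face_word_endo m n (g : cube_hom m n) :
  m = n -> face_word g =1 fun _ => None.
Proof.
have [[s sP] ->] := cube_homP g => E k; rewrite face_word_class /=.
by move: (path_ok_size sP); case: s {sP} => //= x s; lia.
Qed.

(** * Relations into the centre of a brick *)

(** The relations [_coface] below describe the cubes related to a given cube;
    they are inductive in order that case analysis substitutes dimensions and
    face maps at once. *)
Inductive edge_coface (G : graph) (e : edge G) :
    forall k, cube_hom 1 k -> graph_cube G k -> Prop :=
| EdgeCoface : edge_coface e (cube_id 1) (GEdge e).

Lemma edge_cofaceP (G : graph) n k (g : cube_hom n k) (d : graph_cube G k)
    (t : graph_cube G n) :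
  graph_rel g d t ->
  match t in graph_cube _ n return cube_hom n k -> Prop with
  | GVertex _ => fun _ => True
  | GEdge e => fun g => edge_coface e g d
  end g.
Proof. by case=> // n0 [v|e]. Qed.

Inductive vertex_coface (G : graph) (v : vertex G) :
    forall k, cube_hom 0 k -> graph_cube G k -> Prop :=
| CofaceId : vertex_coface v (cube_id 0) (GVertex v)
| CofaceSource e : source e = v -> vertex_coface v (cube_face false ord0) (GEdge e)
| CofaceTarget e : target e = v -> vertex_coface v (cube_face true ord0) (GEdge e).

Lemma vertex_cofaceP (G : graph) n k (g : cube_hom n k) (d : graph_cube G k)
    (t : graph_cube G n) :
  graph_rel g d t ->
  match t in graph_cube _ n return cube_hom n k -> Prop with
  | GVertex v => fun g => vertex_coface v g d
  | GEdge _ => fun _ => True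
  end g.
Proof.
case=> [n0 [v|e]||] //=; by [constructor|move=> e; constructor].
Qed.

Inductive tens_coface (P Q : rpcset) i j (x : P i) (y : Q j) :
    forall k, cube_hom (i + j) k -> tens_cube P Q k -> Prop :=
| TensCoface i' j' (f : cube_hom i i') (g : cube_hom j j') x' y' :
    prel P f x' x -> prel Q g y' y ->
    tens_coface x y (cube_tens f g) (TCube x' y').

Lemma tens_cofaceP (P Q : rpcset) n k (g : cube_hom n k)
    (z : tens_cube P Q k) (t : tens_cube P Q n) :
  tens_rel g z t ->
  match t in tens_cube _ _ n return cube_hom n k -> Prop with
  | TCube i j x y => fun g => tens_coface x y g z
  end g.
Proof. by case=> *; constructor. Qed.

Inductive V_coface b : forall k, cube_hom (vdim b) k -> V b k -> Prop :=
| VCoface a (m : rpcmor (V a) (V b)) h :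
    vmor_iota m h -> V_coface h (m _ (center a)).

Lemma V_cofaceP b k (g : cube_hom (vdim b) k) (d : V b k) :
  prel (V b) g d (center b) -> V_coface g d.
Proof.
have mid c : @vmor_iota c c (mor_id _) (cube_id _) by case: c.
case: b g d => /= g d r.
  case: (vertex_cofaceP r) => [|[] // _|[] // _].
  - exact: (VCoface (mid true)).
  - by apply: (@VCoface true false (graph_edge true)); exists true.
  - by apply: (@VCoface true false (graph_edge false)); exists false.
by case: (edge_cofaceP r); exact: (VCoface (mid false)).
Qed.

(** The cubes above the centre of [Vtens e] are the centres of its sub-bricks:
    this is the bijection between the cubes of a brick and sign vectors. *)
Inductive Vtens_coface e : forall k, cube_hom (bdim e) k -> Vtens e k -> Prop :=
| VtensCoface s (M : rpcmor (Vtens s) (Vtens e)) h :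
    tmor_iota M h -> Vtens_coface h (M _ (centers s)).

Lemma Vtens_cofaceP e k (g : cube_hom (bdim e) k) (d : Vtens e k) :
  prel (Vtens e) g d (centers e) -> Vtens_coface g d.
Proof.
elim: e k g d => [|b e IH] k g d r.
  case: (vertex_cofaceP r) => [|[]|[]].
  exact: (VtensCoface (tmor_iota_id [::])).
case: (tens_cofaceP r) => i j f h x y /V_cofaceP fx /IH hy.
case: _ _ _ / fx => a m {}f mf; case: _ _ _ / hy => s M {}h Mh.
apply: (@VtensCoface (b :: e) (a :: s) (tens_mor m M)).
by exists m, f, M, h.
Qed.

(** The inclusions of bricks are upward closed: the neighbourhood of the centre
    of a sub-brick consists of cubes of this sub-brick. *)
Lemma vmor_iota_coface a b (m : rpcmor (V a) (V b)) h k
    (g : cube_hom (vdim a) k) d :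
  vmor_iota m h -> prel (V b) g d (m _ (center a)) ->
  exists2 d', m _ d' = d & prel (V a) g d' (center a).
Proof.
case: a b m h g d => -[] //= m h g d.
- by case=> -> _ r; exists d.
- case=> e [-> _] r; case: (edge_cofaceP r).
  by exists (@GEdge graph0 tt) => //; exact: GRelId.
- by case=> -> _ r; exists d.
Qed.

Lemma tmor_iota_coface s t (M : rpcmor (Vtens s) (Vtens t)) h k
    (g : cube_hom (bdim s) k) d :
  tmor_iota M h -> prel (Vtens t) g d (M _ (centers s)) ->
  exists2 d', M _ d' = d & prel (Vtens s) g d' (centers s).
Proof.
elim: s t M h k g d => [|a s IH] [|b t] M h k g d //=.
  by case=> -> _ r; exists d.
case=> m [f] [M'] [f'] [mf Mf -> _] r.
case: (tens_cofaceP r) => i j f1 f2 x y fx fy.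
have [x' <- fx'] := vmor_iota_coface mf fx.
have [y' <- fy'] := IH _ _ _ _ _ _ Mf fy.
by exists (TCube x' y') => //; constructor.
Qed.

Lemma tmor_iota_size s t (M : rpcmor (Vtens s) (Vtens t)) h :
  tmor_iota M h -> size s = size t.
Proof.
elim: s t M h => [|a s IH] [|b t] M h //=.
by case=> m [f] [M'] [f'] [_ /IH ->].
Qed.

(** The shape [a] tells whether the coordinate contributes a letter to the word;
    if it does, this letter separates the identity of an edge from its
    inclusions as first and second edge. *)
Lemma vmor_iota_inj a b1 b2 (m1 : rpcmor (V a) (V b1)) (m2 : rpcmor (V a) (V b2))
    h1 h2 (T := fun b => (rpcmor (V a) (V b) * cube_hom (vdim b) (vdim a))%type) :
  vmor_iota m1 h1 -> vmor_iota m2 h2 ->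
  (forall k, k < vdim a -> face_word h1 k = face_word h2 k) ->
  Tagged T (m1, h1) = Tagged T (m2, h2).
Proof.
have fw eta : face_word (@cube_face 0 eta ord0) 0 = Some eta.
  by rewrite face_word_class.
rewrite {}/T; case: a b1 b2 m1 m2 h1 h2 => -[] [] //= m1 m2 h1 h2.
- by case=> -> -> [-> ->].
- case=> e [-> ->] [e' [-> ->]] /(_ 0 isT); rewrite !fw => -[].
  by case: e e' => [] [].
- by case=> e [_ ->] [_ ->] /(_ 0 isT); rewrite fw face_word_id.
- by case=> _ -> [e [_ ->]] /(_ 0 isT); rewrite fw face_word_id.
- by case=> -> -> [-> ->].
Qed.

(** Since the source [s] is fixed, the two words are cut into coordinates at the
    same places. *)
Lemma tmor_iota_inj s t1 t2 (M1 : rpcmor (Vtens s) (Vtens t1))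
    (M2 : rpcmor (Vtens s) (Vtens t2)) h1 h2
    (T := fun t => (rpcmor (Vtens s) (Vtens t) * cube_hom (bdim t) (bdim s))%type) :
  tmor_iota M1 h1 -> tmor_iota M2 h2 -> face_word h1 =1 face_word h2 ->
  Tagged T (M1, h1) = Tagged T (M2, h2).
Proof.
rewrite {}/T; elim: s t1 t2 M1 M2 h1 h2 => [|a s IH] [|b1 t1] [|b2 t2] M1 M2 h1 h2 //=.
  by case=> -> -> [-> ->].
case=> m1 [f1] [M1'] [f1'] [mf1 Mf1 -> ->].
case=> m2 [f2] [M2'] [f2'] [mf2 Mf2 -> ->] E.
have E1 k : k < vdim a -> face_word f1 k = face_word f2 k.
  by move=> ka; have := E k; rewrite !face_word_tens ka.
have E2 k : face_word f1' k = face_word f2' k.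
  by have := E (vdim a + k); rewrite !face_word_tens ltnNge leq_addr addKn.
move: (vmor_iota_inj mf1 mf2 E1) (IH _ _ _ _ _ _ Mf1 Mf2 E2).
move=> {IH E E1 E2 mf1 mf2 Mf1 Mf2} F G.
(* Equality of pairs [tens_mor m M', cube_tens f f'] in one congruence. *)
pose TV b := (rpcmor (V a) (V b) * cube_hom (vdim b) (vdim a))%type.
pose TT t := (rpcmor (Vtens s) (Vtens t) * cube_hom (bdim t) (bdim s))%type.
pose T t := (rpcmor (Vtens (a :: s)) (Vtens t) *
             cube_hom (bdim t) (bdim (a :: s)))%type.
pose cons_iota (u : {b & TV b}) (v : {t & TT t}) : {t & T t} :=
  @Tagged _ (tag u :: tag v) T
    (tens_mor (tagged u).1 (tagged v).1, cube_tens (tagged u).2 (tagged v).2).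
exact: (congr2 cons_iota F G).
Qed.

Lemma mor_compA P Q R S (h : rpcmor R S) (g : rpcmor Q R) (f : rpcmor P Q) :
  h \c (g \c f) = h \c g \c f.
Proof. exact: rpcmor_ext. Qed.

Lemma mor_comp1 P Q (f : rpcmor P Q) : f \c mor_id P = f.
Proof. exact: rpcmor_ext. Qed.

(** * Cubes of bricks *)

Lemma up_to_self (P : rpcset) k (c : P k) m (x : up c m) :
  prel (up c) (up_mor x) x (up_self c).
Proof. by split; [exact: up_baseP|rewrite cube_comp_idr]. Qed.

Section Bricks.
Variable n : nat.
Implicit Types e s t : n.-tuple bool.

Inductive brick_view e : forall k, brick e k -> Prop :=
| BrickView s (m : rpcmor (brick s) (brick e)) :
    bmor_iota m -> brick_view (m _ (bmin s)).

Lemma brickP e k (x : brick e k) : brick_view x.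
Proof.
case: x => d g r; case: (Vtens_cofaceP r) (r) => s M h Mh {d g}r.
have sP : size s == n by rewrite (tmor_iota_size Mh) size_tuple.
have -> : UpCube r = up_map r _ (bmin (Tuple sP)).
  by apply: up_cube_ext; rewrite //= cube_comp_idl.
by apply: (@BrickView e (Tuple sP)); exists M, h, r.
Qed.

(** Inclusions of sub-bricks are charts. *)
Lemma bmor_iota_coface s e (m : rpcmor (brick s) (brick e)) k
    (g : cube_hom (bdim s) k) (x : brick e k) :
  bmor_iota m -> prel (brick e) g x (m _ (bmin s)) ->
  exists2 x', m _ x' = x & up_mor x' = g.
Proof.
case=> M [h] [r] [Mh ->] [xs E]; have [d dx ds] := tmor_iota_coface Mh xs.
exists (UpCube ds) => //; apply: up_cube_ext => //=.
by rewrite E /= cube_comp_idl.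
Qed.

(** A sub-brick is determined by its shape and the word that relates it to the
    minimal cube, even when the ambient brick is not given. Knowing the word
    alone does not suffice: all edges of a brick that point into a minimal cube
    of dimension 0 have one of the words + and -. *)
Lemma bmor_iota_inj s e1 e2 (m1 : rpcmor (brick s) (brick e1))
    (m2 : rpcmor (brick s) (brick e2)) :
  bmor_iota m1 -> bmor_iota m2 ->
  face_word (up_mor (m1 _ (bmin s))) =1 face_word (up_mor (m2 _ (bmin s))) ->
  Tagged (fun e : n.-tuple bool => rpcmor (brick s) (brick e)) m1 = Tagged _ m2.
Proof.
case=> M1 [h1] [r1] [Mh1 ->] [M2] [h2] [r2] [Mh2 ->].
rewrite /= !cube_comp_idl => E.
have F := tmor_iota_inj Mh1 Mh2 E.
have e12 : e1 = e2 by apply: val_inj; exact: (congr1 tag F).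
subst e2; have {F}[FM Fh] := Tagged_inj F; subst M2 h2.
by rewrite (Prop_irrelevance r1 r2).
Qed.

Lemma brick_iota e k (x : brick e k) :
  exists s (m : rpcmor (brick s) (brick e)),
    bmor_iota m /\ Tagged (brick e) (m _ (bmin s)) = Tagged (brick e) x.
Proof. by case/brickP: x => s m mi; exists s, m. Qed.

(** A relation between cubes of equal dimension has the trivial word, which is
    also the word of the inclusion of the whole brick. *)
Lemma brick_min e k (x : brick e k) :
  k = bdim e -> Tagged (brick e) x = Tagged (brick e) (bmin e).
Proof.
case/brickP: x => s m mi E.
have W : face_word (up_mor (m _ (bmin s))) =1 face_word (up_mor (bmin s)).
  by move=> i; rewrite !face_word_endo.
have F := bmor_iota_inj mi (bmor_iota_id s) W; have /= es := congr1 tag F.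
by subst s; rewrite (Tagged_inj F).
Qed.

Lemma bdim_eq_full e : bdim e = n -> e = nseq_tuple n false.
Proof.
move=> E; apply: val_inj => /=.
have := codim_bdim e; rewrite E size_tuple => {}E.
have -> : nseq n false = nseq (size e) false by rewrite size_tuple.
apply/all_pred1P; rewrite all_count.
apply/eqP; rewrite size_tuple.
have := count_predC id e; rewrite size_tuple.
have -> : count (predC id) e = count (pred1 false) e by apply: eq_count => -[].
by rewrite /codim in E; lia.
Qed.

Lemma bdim_full : bdim (nseq_tuple n false) = n.
Proof. by rewrite /=; elim: (n) => //= k ->. Qed.

Lemma brick_full e : exists m : rpcmor (brick (nseq_tuple n false)) (brick e),
  bmor_iota m.
Proof.
have [M [h Mh]] : exists (M : rpcmor (Vtens (nseq (size e) false)) (Vtens e)) h,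
    tmor_iota M h.
  elim: (tval e) => [|b s [M] [h] Mh] /=.
    by exists (mor_id _), (cube_id _).
  have [m [f mf]] : exists (m : rpcmor (V false) (V b)) f, vmor_iota m f.
    case: b => /=; last by exists (mor_id _), (cube_id 1).
    (* Either of the two edges would do. *)
    by exists (graph_edge true), (cube_face false ord0); exists true.
  by exists (tens_mor m M), (cube_tens f h), m, f, M, h.
rewrite size_tuple in M h Mh.
have r : prel (Vtens e) h (M _ (centers (nseq n false))) (centers e).
  case/tmor_iotaP: Mh => w; exact: Viota_centers.
by exists (up_map r), M, h, r.
Qed.

Lemma brick_full_word e k (x : brick e k) : k = n ->
  exists2 m : rpcmor (brick (nseq_tuple n false)) (brick e),
    bmor_iota m & face_word (up_mor x) =1 face_word (up_mor (m _ (bmin _))).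
Proof. by case/brickP: x => s m mi /bdim_eq_full E; subst s; exists m. Qed.

(** * Charts and their rigidity *)

Definition chart (P : rpcset) e (f : rpcmor (brick e) P) : Prop :=
  forall m (g : cube_hom (bdim e) m) a, prel P g a (f _ (bmin e)) ->
  exists2 x, f m x = a & up_mor x = g.

(** Inductive, so that case analysis replaces a cube by the centre of a chart
    without a transport along an equality of dimensions. *)
Inductive has_chart (P : rpcset) : forall k, P k -> Prop :=
| HasChart e (f : rpcmor (brick e) P) : chart f -> has_chart (f _ (bmin e)).

Definition charted (P : rpcset) : Prop := forall k (c : P k), has_chart c.

Lemma has_chartP (P : rpcset) k (c : P k) : has_chart c ->
  exists e (f : rpcmor (brick e) P),
    chart f /\ Tagged P (f _ (bmin e)) = Tagged P c.
Proof. by case=> e f ch; exists e, f. Qed.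

(** The chart property for a cube which equals the centre of the chart only up
    to a change of dimension; words replace face maps, whose types differ. *)
Lemma chart_tagged (P : rpcset) e (f : rpcmor (brick e) P) k (c : P k) m
    (g : cube_hom k m) a :
  chart f -> Tagged P (f _ (bmin e)) = Tagged P c -> prel P g a c ->
  exists2 x, f m x = a & face_word (up_mor x) =1 face_word g.
Proof.
move=> ch E; have: forall (u : {k & P k}), Tagged P (f _ (bmin e)) = u ->
    forall (g : cube_hom (tag u) m), prel P g a (tagged u) ->
    exists2 x, f m x = a & face_word (up_mor x) =1 face_word g.
  by move=> u <- /= {}g /ch [x fx <-]; exists x.
by move/(_ _ E g).
Qed.

(** A maximal cube of [brick e1] has an image above the centre of [f1], hence a
    preimage along the chart [f], of the same dimension n. Both are maximal
    cubes with the same word, and maximal cubes all have the same shape. *)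
Lemma chart_shape (P : rpcset) e1 e (f1 : rpcmor (brick e1) P)
    (f : rpcmor (brick e) P) :
  chart f -> Tagged P (f _ (bmin e)) = Tagged P (f1 _ (bmin e1)) -> e1 = e.
Proof.
move=> ch E; have [m mi] := brick_full e1.
have [x _ xw] := chart_tagged ch E (mor_rel f1 (up_to_self (m _ (bmin _)))).
have [m' mi' W] := brick_full_word x bdim_full.
have F : face_word (up_mor (m _ (bmin _))) =1 face_word (up_mor (m' _ (bmin _))).
  by move=> i; rewrite -W xw.
by have /= := congr1 tag (bmor_iota_inj mi mi' F).
Qed.

(** It suffices to compare a morphism [f'] with a chart [f] at its centre. The
    image under [f'] of any cube [z] of the brick is also the image under [f] of
    some [x] with the word of [z]. The shape of a cube of a brick depends only
    on its image in [P], so [x] and [z] also have the same shape, and they are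
    equal. *)
Theorem chart_unique (P : rpcset) e1 e2 (f1 : rpcmor (brick e1) P)
    (f2 : rpcmor (brick e2) P) :
  charted P -> Tagged P (f1 _ (bmin e1)) = Tagged P (f2 _ (bmin e2)) ->
  Tagged (fun e : n.-tuple bool => rpcmor (brick e) P) f1 = Tagged _ f2.
Proof.
move=> cP E.
have shape s1 s2 (g1 : rpcmor (brick s1) P) (g2 : rpcmor (brick s2) P) :
    Tagged P (g1 _ (bmin s1)) = Tagged P (g2 _ (bmin s2)) -> s1 = s2.
  move=> E12; have [s [g [ch Eg]]] := has_chartP (cP _ (g1 _ (bmin s1))).
  rewrite (chart_shape ch Eg); apply: esym.
  exact: chart_shape ch (etrans Eg E12).
have [e [f [ch Ef]]] := has_chartP (cP _ (f1 _ (bmin e1))).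
suff uniq e' (f' : rpcmor (brick e') P) :
    Tagged P (f _ (bmin e)) = Tagged P (f' _ (bmin e')) ->
    Tagged (fun e : n.-tuple bool => rpcmor (brick e) P) f' = Tagged _ f.
  by rewrite (uniq _ f1 Ef) (uniq _ f2) // Ef E.
move=> {E Ef}E; have ee' := shape _ _ _ _ E; subst e'.
congr Tagged; apply: rpcmor_ext => k z; case/brickP: z => s m mi.
have [x fx] := chart_tagged ch E (mor_rel f' (up_to_self (m _ (bmin s)))).
move=> xw; have [s' [m' [mi' Ex]]] := brick_iota x.
have ss' : s = s'.
  apply: (shape _ _ (f' \c m) (f \c m')) => /=; rewrite -fx.
  exact: esym (congr1 (fun u => Tagged P (f _ (tagged u))) Ex).
subst s'; have {}Ex := Tagged_inj Ex; subst x.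
by rewrite -fx (Tagged_inj (bmor_iota_inj mi' mi xw)).
Qed.

(** * Euclidean means charted *)

Definition up_proj (P : rpcset) k (c : P k) : rpcmor (up c) P :=
  @RPCMor (up c) P (@up_base P k c) (fun _ _ _ _ _ ab => ab.1).

(** A surjection from a brick onto [up c] automatically sends the minimal cube
    to [c]: relations only raise the dimension, so a preimage of [c] has at
    least the dimension of the minimal cube, and the image of the minimal cube
    has at least the dimension of [c]. *)
Lemma up_surjective_chart (P : rpcset) e k (c : P k) (f : rpcmor (brick e) (up c)) :
  mor_surjective f -> has_chart c.
Proof.
move=> fs; have [x fx] := fs _ (up_self c).
have E : k = bdim e.
  apply/eqP; rewrite eqn_leq (cube_hom_leq (up_mor (f _ (bmin e)))).
  exact: cube_hom_leq (up_mor x).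
subst k; have {x fx}fmin : f _ (bmin e) = up_self c.
  by rewrite -fx (Tagged_inj (brick_min x erefl)).
have -> : c = (up_proj c \c f) _ (bmin e) by rewrite /= fmin.
constructor => m g a /=; rewrite fmin => ac.
have [x fx] := fs _ (UpCube ac); exists x; first by rewrite fx.
have [_] := mor_rel f (up_to_self x).
by rewrite -/(bmin e) fmin fx /= cube_comp_idr.
Qed.

Definition up_lift (P : rpcset) e (f : rpcmor (brick e) P) :
    rpcmor (brick e) (up (f _ (bmin e))).
Proof.
exists (fun k x => UpCube (mor_rel f (up_to_self x))) => k m g a b ab.
by split; [exact: mor_rel ab|exact: ab.2].
Defined.

(** Being a local embedding is a consequence of rigidity: two cubes of the brick
    with the same image have the same shape, and if they share a face by the
    same face map then they also have the same word. *)
Lemma charted_euclidean P : euclidean n P <-> charted P.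
Proof.
split=> [eP k c|cP k c].
  by have [e [f [fs _]]] := eP k c; exact: up_surjective_chart fs.
case: (cP k c) => e f ch; exists e, (up_lift f); split=> [m [a g ac]|].
  by have [x fx gx] := ch _ _ _ ac; exists x; exact: up_cube_ext.
move=> m a b ab [l [w [d [[_ wa] [_ wb]]]]] /= Eab; apply: ab.
have {Eab}Eab : f _ a = f _ b := congr1 (@up_base _ _ _ _) Eab.
have {wa wb} : up_mor a = up_mor b by rewrite wa wb.
case/brickP: a b Eab => s ma mai b.
have [s' [mb [mbi Eb]]] := brick_iota b; move=> Eab Mab.
have ss' : s = s'.
  suff F : Tagged P ((f \c ma) _ (bmin s)) = Tagged P ((f \c mb) _ (bmin s')).
    by have /= := congr1 tag (chart_unique cP F).
  rewrite /= Eab; exact: esym (congr1 (fun u => Tagged P (f _ (tagged u))) Eb).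
subst s'; have {}Eb := Tagged_inj Eb; subst b.
suff F : face_word (up_mor (ma _ (bmin s))) =1 face_word (up_mor (mb _ (bmin s))).
  by rewrite (Tagged_inj (bmor_iota_inj mai mbi F)).
by rewrite Mab.
Qed.

Lemma brick_charted e : charted (brick e).
Proof.
move=> k x; case/brickP: x => s m mi; constructor => l g a.
exact: bmor_iota_coface.
Qed.

(** Rigidity applied to the brick itself: [m] and the inclusion of the sub-brick
    at the cube [m _ (bmin s)] have the same centre. *)
Lemma brick_mor_iota s e (m : rpcmor (brick s) (brick e)) : bmor_iota m.
Proof.
have [s' [m' [mi' E]]] := brick_iota (m _ (bmin s)).
have F := chart_unique (@brick_charted e) E.
by have /= es := congr1 tag F; subst s'; rewrite -(Tagged_inj F).
Qed.

(** * Gluing along charts *)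

(** A cube of a charted [P] is the same as a morphism from a brick to [P], so a
    morphism out of [P] is a compatible choice of one cube for each of these. *)
Section Glue.
Variables (P Z : rpcset) (cP : charted P).
Variable val : forall e, rpcmor (brick e) P -> Z (bdim e).
Hypothesis val_rel : forall s e (m : rpcmor (brick s) (brick e))
    (g : cube_hom (bdim e) (bdim s)) (f : rpcmor (brick e) P),
  prel (brick e) g (m _ (bmin s)) (bmin e) -> prel Z g (val (f \c m)) (val f).

Inductive glue_rel : forall k, P k -> Z k -> Prop :=
| GlueRel e (f : rpcmor (brick e) P) : glue_rel (f _ (bmin e)) (val f).

Lemma glue_ex k (c : P k) : exists z, glue_rel c z.
Proof. by case: (cP c) => e f _; exists (val f). Qed.

Definition glue_fun k (c : P k) : Z k := projT1 (cid (glue_ex c)).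

Lemma glue_fun_val e (f : rpcmor (brick e) P) : glue_fun (f _ (bmin e)) = val f.
Proof.
rewrite /glue_fun; case: cid => z /= r.
suff H k (c : P k) (z' : Z k) : glue_rel c z' ->
    Tagged P c = Tagged P (f _ (bmin e)) -> Tagged Z z' = Tagged Z (val f).
  exact: Tagged_inj (H _ _ _ r erefl).
case=> e' f' /(chart_unique cP) F.
by have /= := congr1 (fun u : {e : n.-tuple bool & rpcmor (brick e) P} =>
  Tagged Z (val (tagged u))) F.
Qed.

Lemma glue_rel_mor m k (g : cube_hom m k) (a : P k) (b : P m) :
  prel P g a b -> prel Z g (glue_fun a) (glue_fun b).
Proof.
case: (cP b) g a => e f ch g a /ch [x <- <-]; move: (up_to_self x).
case/brickP: x => s m' mi r; rewrite (glue_fun_val f) (glue_fun_val (f \c m')).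
exact: val_rel.
Qed.

Definition glue : rpcmor P Z := RPCMor glue_rel_mor.

End Glue.

(** * The blowup *)

Inductive blowup_coface P e (f : rpcmor (brick e) P) :
    forall k, cube_hom (bdim e) k -> blowup_cube n P k -> Prop :=
| BlowupCoface s (m : rpcmor (brick s) (brick e)) h :
    prel (brick e) h (m _ (bmin s)) (bmin e) ->
    blowup_coface f h (BCube (f \c m)).

Lemma blowup_cofaceP P k m (g : cube_hom m k) (a : blowup n P k)
    (b : blowup n P m) :
  prel (blowup n P) g a b ->
  match b in blowup_cube _ _ m return cube_hom m k -> Prop with
  | BCube e f => fun g => blowup_coface f g a
  end g.
Proof. by case=> *; constructor. Qed.

Definition bcube_comp P e (f : rpcmor (brick e) P) s
  (m : rpcmor (brick s) (brick e)) : blowup n P (bdim s) := BCube (f \c m).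

Lemma bcube_comp_rel P e (f : rpcmor (brick e) P) s t
    (m : rpcmor (brick s) (brick t)) (g : cube_hom (bdim t) (bdim s))
    (i : rpcmor (brick t) (brick e)) :
  prel (brick t) g (m _ (bmin s)) (bmin t) ->
  prel (blowup n P) g (bcube_comp f (i \c m)) (bcube_comp f i).
Proof. exact: (@blowup_relI n P s t (f \c i) m g (brick_mor_iota m)). Qed.

(** The lift of [f] to the blowup, sending each cube of the brick to the
    restriction of [f] to the sub-brick of this cube. *)
Definition sharp P e (f : rpcmor (brick e) P) : rpcmor (brick e) (blowup n P) :=
  glue (@brick_charted e) (@bcube_comp_rel P e f).

Lemma sharp_min P e (f : rpcmor (brick e) P) s (m : rpcmor (brick s) (brick e)) :
  sharp f _ (m _ (bmin s)) = BCube (f \c m).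
Proof. exact: glue_fun_val. Qed.

Lemma sharp_bmin P e (f : rpcmor (brick e) P) : sharp f _ (bmin e) = BCube f.
Proof.
have -> : bmin e = mor_id (brick e) _ (bmin e) by [].
by rewrite sharp_min; congr BCube; exact: rpcmor_ext.
Qed.

Lemma blowup_charted P : charted (blowup n P).
Proof.
move=> k c; case: c => e f; rewrite -sharp_bmin; constructor => m g a.
rewrite sharp_bmin => /blowup_cofaceP [s i h hi].
exists (i _ (bmin s)); first by rewrite sharp_min.
by have [_ ->] := hi; rewrite /= cube_comp_idr.
Qed.

Lemma blowup_map_sharp P e (f : rpcmor (brick e) P) :
  blowup_map n P \c sharp f = f.
Proof.
apply: rpcmor_ext => k x; case/brickP: x => s m _.
by have /= := congr1 (@blowup_map_fun n P _) (sharp_min f m).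
Qed.

(** As [sharp f] is centred at the cube [f] of the blowup, rigidity makes it the
    only such morphism: a morphism from a brick to the blowup is [sharp] of its
    composite with the blowup map. *)
Lemma mor_blowup_bmin P e (h : rpcmor (brick e) (blowup n P)) :
  h _ (bmin e) = BCube (blowup_map n P \c h).
Proof.
have [e' [f E]] : exists e' (f : rpcmor (brick e') P),
    Tagged (blowup n P) (sharp f _ (bmin e')) = Tagged (blowup n P) (h _ (bmin e)).
  by case: (h _ _) => e' f; exists e', f; rewrite sharp_bmin.
have F := chart_unique (@blowup_charted P) E.
have /= ee' := congr1 tag F; subst e'; rewrite -(Tagged_inj F) sharp_bmin.
by rewrite blowup_map_sharp.
Qed.

Lemma blowup_map_inj P Q (h1 h2 : rpcmor Q (blowup n P)) : charted Q ->
  blowup_map n P \c h1 = blowup_map n P \c h2 -> h1 = h2.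
Proof.
move=> cQ E; apply: rpcmor_ext => k c; case: (cQ k c) => e f _.
have := mor_blowup_bmin (h1 \c f); have := mor_blowup_bmin (h2 \c f).
by rewrite !mor_compA E /= => -> ->.
Qed.

End Bricks.

(** * Codiagonals and unique lifting *)

(** Codiagonals are given by a universal property, so using the lifting property
    against them requires a construction of the pushout of an inclusion with
    itself: a second copy of the cubes outside [A] is added, and the relations
    are generated under composition by those of the two copies of [P]. *)
Section CokernelPair.
Variables (P : rpcset) (A : forall k, P k -> Prop).

Definition cokernel_cube k := (P k + {x : P k | ~ A x})%type.

Definition coker_inl k (x : P k) : cokernel_cube k := inl x.

Definition coker_inr k (x : P k) : cokernel_cube k :=
  match pselect (A x) with
  | left _ => inl x
  | right nAx => inr (exist _ x nAx)
  end.

Inductive coker_rel : forall m k,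
    cube_hom m k -> cokernel_cube k -> cokernel_cube m -> Prop :=
| CokerId k (x : cokernel_cube k) : coker_rel (cube_id k) x x
| CokerInl m k (g : cube_hom m k) a b :
    prel P g a b -> coker_rel g (coker_inl a) (coker_inl b)
| CokerInr m k (g : cube_hom m k) a b :
    prel P g a b -> coker_rel g (coker_inr a) (coker_inr b)
| CokerComp m k l (f : cube_hom k l) (g : cube_hom m k) a b e :
    coker_rel f a b -> coker_rel g b e -> coker_rel (cube_comp f g) a e.

Definition coker : rpcset := RPCSet CokerId CokerComp.

Definition coker_j1 : rpcmor P coker := @RPCMor P coker coker_inl CokerInl.
Definition coker_j2 : rpcmor P coker := @RPCMor P coker coker_inr CokerInr.

Section CokerMap.
Variables (Y : rpcset) (u v : rpcmor P Y).
Hypothesis uv : u \c restr_incl A = v \c restr_incl A.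

Definition coker_map_fun k (x : coker k) : Y k :=
  match x with inl y => u _ y | inr y => v _ (sval y) end.

Lemma coker_map_inr k (x : P k) : coker_map_fun (coker_inr x) = v _ x.
Proof.
rewrite /coker_inr; case: pselect => //= Ax.
by have /= := congr1 (fun h : rpcmor (restr A) Y => h _ (exist _ x Ax)) uv.
Qed.

Lemma coker_map_rel m k (g : cube_hom m k) (a : coker k) (b : coker m) :
  prel coker g a b -> prel Y g (coker_map_fun a) (coker_map_fun b).
Proof.
elim=> {m k g a b}.
- by move=> k x; exact: prel_id.
- by move=> m k g a b ab; exact: mor_rel ab.
- by move=> m k g a b ab; rewrite !coker_map_inr; exact: mor_rel ab.
- by move=> m k l f g a b e _ ab _ be; exact: prel_comp be.
Qed.

Definition coker_map : rpcmor coker Y := RPCMor coker_map_rel.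

End CokerMap.

Lemma coker_pushout : is_pushout (restr_incl A) (restr_incl A) coker_j1 coker_j2.
Proof.
split.
  apply: rpcmor_ext => k [x Ax] /=; rewrite /coker_inr.
  by case: pselect => // nAx; case: (nAx Ax).
move=> Y u v uv; exists (coker_map uv); split.
  by split; apply: rpcmor_ext => k x //=; exact: coker_map_inr.
move=> h [hu hv]; apply: rpcmor_ext => k [x|[x nAx]] /=; first by rewrite -hu.
rewrite -hv /= /coker_inr; case: pselect => [Ax|nAx']; first by case: (nAx Ax).
by congr (h _ (inr _)); congr exist; exact: Prop_irrelevance.
Qed.

End CokernelPair.

Definition unique_lifting A B X Y (i : rpcmor A B) (p : rpcmor X Y) : Prop :=
  has_lifting i p /\
  forall h1 h2 : rpcmor B X, h1 \c i = h2 \c i -> p \c h1 = p \c h2 -> h1 = h2.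

(** Two lifts [h1], [h2] of the same square form a morphism out of the pushout,
    and a lift against the codiagonal is a common value of both. *)
Lemma RLP_gen_cof n X Y (p : rpcmor X Y) :
  RLP (@gen_cof n) p <->
  forall e : n.-tuple bool, unique_lifting (brick_incl e) p.
Proof.
split=> [rp e|pU A B i].
  split; first by apply: rp; constructor.
  move=> h1 h2 h12 ph; have po := @coker_pushout (brick e)
    (fun k x => Tagged (brick e) x <> Tagged (brick e) (bmin e)).
  have [h [[hj1 hj2] _]] := po.2 _ h1 h2 h12.
  have [nabla [[n1 n2] _]] := po.2 _ (mor_id _) (mor_id _) erefl.
  have cod : is_codiagonal (brick_incl e) nabla by exists (coker_j1 _), (coker_j2 _).
  have sq : p \c h = (p \c h1) \c nabla.
    have [k [_ ku]] := po.2 _ (p \c h1) (p \c h1) erefl.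
    rewrite -(ku (p \c h)); last by rewrite -!mor_compA hj1 hj2.
    by rewrite -(ku (p \c h1 \c nabla)) // -!mor_compA n1 n2.
  have [l [ln _]] := rp _ _ _ (GenCodiag cod) _ _ sq.
  by rewrite -hj1 -hj2 -ln -!mor_compA n1 n2.
case=> {A B i} [e|e Z nabla [j1 [j2 [po n1 n2]]]]; first exact: (pU e).1.
move=> u v uv; exists (u \c j1).
have vE : p \c (u \c j1) = v by rewrite mor_compA uv -mor_compA n1 mor_comp1.
split=> //; have jj : u \c j1 \c brick_incl e = u \c j2 \c brick_incl e.
  by rewrite -!mor_compA po.1.
have [k [_ ku]] := po.2 _ _ _ jj.
have E : u \c j1 = u \c j2.
  apply: (pU e).2 => //.
  by rewrite vE mor_compA uv -mor_compA n2 mor_comp1.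
apply: (etrans (esym (ku (u \c j1 \c nabla) _)) (ku u _)) => //.
by split; rewrite -mor_compA ?n1 ?n2 mor_comp1 ?E.
Qed.

(** * Lifting along trivial fibrations *)

Section Lifting.
Variable n : nat.
Implicit Types e s t : n.-tuple bool.

Lemma charted_restr (P : rpcset) (A : forall k, P k -> Prop) :
  (forall m k (g : cube_hom m k) a b, prel P g a b -> A m b -> A k a) ->
  charted n P -> charted n (restr A).
Proof.
move=> A_up cP k [c Ac]; case: (cP k c) Ac => e f ch Ac.
pose f_fun m (x : brick e m) : restr A m :=
  exist _ (f m x) (A_up _ _ _ _ _ (mor_rel f (up_to_self x)) Ac).
have f_rel m l (g : cube_hom m l) (a : brick e l) (b : brick e m) :
  prel (brick e) g a b -> prel (restr A) g (f_fun l a) (f_fun m b) :=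
    @mor_rel _ _ f _ _ g a b.
have -> : exist _ (f _ (bmin e)) Ac = RPCMor f_rel _ (bmin e).
  by congr exist; exact: Prop_irrelevance.
constructor=> m g [a Aa] /ch [x fx gx]; exists x => //=.
rewrite /f_fun; move: (A_up _ _ _ _ _ _ _); rewrite fx => Aa'.
by congr exist; exact: Prop_irrelevance.
Qed.

(** The minimal cube is the only one of its dimension. *)
Lemma boundary_dim e k (x : brick e k) :
  Tagged (brick e) x <> Tagged (brick e) (bmin e) <-> bdim e < k.
Proof.
split=> [nx|ek E].
  rewrite ltn_neqAle (cube_hom_leq (up_mor x)) andbT.
  by apply/eqP => E; apply: nx; apply: brick_min.
by have /= Ek := congr1 tag E; rewrite Ek ltnn in ek.
Qed.

Lemma boundary_charted e : charted n (brick_boundary e).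
Proof.
apply: charted_restr (@brick_charted n e) => m k g a b _ /boundary_dim em.
exact/boundary_dim/(leq_trans em)/(cube_hom_leq g).
Qed.

Variables (X Y : rpcset) (p : rpcmor X Y).

Definition brick_bijective e : Prop :=
  forall v : rpcmor (brick e) Y, exists! h : rpcmor (brick e) X, p \c h = v.

(** If lifts exist and are unique on the bricks that map to [P], then they are
    compatible and glue. Restricting to these bricks is what makes the induction
    on the codimension possible, where [P] is the boundary of a brick. *)
Section LiftCharted.
Variables (P : rpcset) (cP : charted n P) (v : rpcmor P Y).
Hypothesis bij : forall e, rpcmor (brick e) P -> brick_bijective e.

Definition local_lift e (f : rpcmor (brick e) P) : rpcmor (brick e) X :=
  projT1 (cid (bij f (v \c f))).

Lemma local_liftK e (f : rpcmor (brick e) P) : p \c local_lift f = v \c f.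
Proof. by rewrite /local_lift; case: cid => h []. Qed.

Lemma local_lift_uniq e (f : rpcmor (brick e) P) h :
  p \c h = v \c f -> h = local_lift f.
Proof. by rewrite /local_lift; case: cid => l [_ lu] /= /lu. Qed.

Lemma local_lift_rel s e (m : rpcmor (brick s) (brick e))
    (g : cube_hom (bdim e) (bdim s)) (f : rpcmor (brick e) P) :
  prel (brick e) g (m _ (bmin s)) (bmin e) ->
  prel X g (local_lift (f \c m) _ (bmin s)) (local_lift f _ (bmin e)).
Proof.
move=> r; rewrite -(@local_lift_uniq _ (f \c m) (local_lift f \c m)).
  exact: mor_rel r.
by rewrite !mor_compA local_liftK.
Qed.

Lemma lift_charted : exists h : rpcmor P X, p \c h = v.
Proof.
exists (glue cP local_lift_rel); apply: rpcmor_ext => k c.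
case: (cP c) => e f _ /=; rewrite glue_fun_val.
by have /= := congr1 (fun h : rpcmor (brick e) Y => h _ (bmin e)) (local_liftK f).
Qed.

Lemma lift_charted_uniq (h1 h2 : rpcmor P X) : p \c h1 = p \c h2 -> h1 = h2.
Proof.
move=> E; apply: rpcmor_ext => k c; case: (cP c) => e f _.
have [h [_ hu]] := bij f (p \c h1 \c f).
have F : h1 \c f = h2 \c f.
  by rewrite -(hu (h1 \c f)) ?mor_compA // -(hu (h2 \c f)) // E mor_compA.
by have /= := congr1 (fun h : rpcmor (brick e) X => h _ (bmin e)) F.
Qed.

End LiftCharted.

Hypothesis pU : forall e, unique_lifting (brick_incl e) p.

Lemma boundary_brick_dim e s (f : rpcmor (brick s) (brick_boundary e)) :
  bdim e < bdim s.
Proof.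
by case: (f _ (bmin s)) => x /boundary_dim.
Qed.

(** Only bricks of smaller codimension map to the boundary; so the induction
    determines the lift on the boundary, and unique lifting extends it to the
    minimal cube. *)
Lemma brick_bij e : brick_bijective e.
Proof.
have [k] := ubnP (n - bdim e); elim: k e => // k IH e ek.
have bij s : rpcmor (brick s) (brick_boundary e) -> brick_bijective s.
  move=> f; apply: IH; have := boundary_brick_dim f.
  by have := codim_bdim s; rewrite size_tuple; lia.
move=> v.
have [u pu] := lift_charted (@boundary_charted e) (v \c brick_incl e) bij.
have [h [_ ph]] := (pU e).1 u v pu; exists h; split=> // h' ph'.
apply: (pU e).2; last by rewrite ph.
by apply: (lift_charted_uniq (@boundary_charted e) bij); rewrite !mor_compA ph ph'.
Qed.

Lemma charted_lift P : charted n P -> has_lifting (from_empty P) p.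
Proof.
move=> cP u v uv; have [h ph] := lift_charted cP v (fun e _ => @brick_bij e).
by exists h; split=> //; apply: rpcmor_ext => k [].
Qed.

End Lifting.

(** [sharp v] is the unique lift of [v] to the blowup; since the boundary is
    charted, it restricts to the prescribed morphism there. *)
Lemma blowup_map_RLP n P : RLP (@gen_cof n) (blowup_map n P).
Proof.
apply/RLP_gen_cof => e; split=> [u v uv|h1 h2 _].
  exists (sharp v); split; last exact: blowup_map_sharp.
  apply: (blowup_map_inj (@boundary_charted _ e)).
  by rewrite mor_compA blowup_map_sharp.
by apply: blowup_map_inj; exact: brick_charted.
Qed.

(** For [y] in the image of the section [s], relations into [r y] are sent by
    [s] to relations into [y], which the chart at [y] lifts to the brick. *)
Lemma charted_retract n P Q (s : rpcmor P Q) (r : rpcmor Q P) :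
  r \c s = mor_id P -> charted n Q -> charted n P.
Proof.
move=> rs cQ k c.
have rsE m (x : P m) : r _ (s _ x) = x.
  by have /= := congr1 (fun h : rpcmor P P => h _ x) rs.
suff H (y : Q k) : s _ (r _ y) = y -> has_chart n (r _ y).
  by rewrite -(rsE _ c); apply: H; rewrite rsE.
case: (cQ k y) => e f ch sr; apply: (@HasChart n P e (r \c f)) => m g a.
by move/(mor_rel s); rewrite /= sr => /ch [x fx gx]; exists x; rewrite //= fx rsE.
Qed.

(** The lift of the identity of a cofibrant [P] along the blowup map is a
    section, which makes [P] a retract of its blowup. *)
Theorem cofibrant_charted n P : cofibrant (euclidean_model n) P <-> charted n P.
Proof.
split=> [cof|cP X Y p /RLP_gen_cof pU]; last exact: charted_lift.
have [|h [_ hP]] :=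
  cof _ _ _ (@blowup_map_RLP n P) (from_empty _) (mor_id P) _.
  by apply: rpcmor_ext => k [].
exact: charted_retract hP (@blowup_charted n P).
Qed.

Theorem theorem30 :
  forall n : nat,
    (forall P : rpcset, cofibrant (euclidean_model n) P <-> euclidean n P) /\
    (forall P : rpcset,
       cofibrant_replacement (euclidean_model n) (blowup_map n P)).
Proof.
move=> n; split=> P.
  by split=> [/cofibrant_charted/charted_euclidean|/charted_euclidean/cofibrant_charted].
split; last by split=> //; exact: blowup_map_RLP.
exact/cofibrant_charted/blowup_charted.
Qed.
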